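(* Let $\gamma>0$, let $\Omega\subset\mathbb{R}^n$ be a bounded Lipschitz domain and let $f$ be locally Hölder continuous in $\Omega$ with $0<\lambda\le f(X)\le\Lambda$. Then the (nonnegative) solution $u$ of $$-\Delta u=f(X)u^{-\gamma}\ \text{ in }\Omega,\qquad u=0\ \text{ on }\partial\Omega$$ is $C^\mu(\overline\Omega)$ for some $\mu>0$ depending on $(\gamma,[\partial\Omega]_{C^{0,1}})$. Specifically: (a) If $\gamma>1$ and $\Omega$ is a $C^1$ or convex domain, then $u\in C^{\frac{2}{1+\gamma}}(\overline\Omega)$ and $$u(X)\sim d(X,\partial\Omega)^{\frac2{1+\gamma}}.$$ (b1) If $\gamma<1$ and $\partial\Omega$ is a $C^1$ graph near the origin, then $$u(X)\gtrsim d^{\alpha}(X,\partial\Omega)\quad\text{for any }\alpha>1.$$ (b2) If $\gamma<1$ and $\partial\Omega$ is a concave graph near the origin, then $$u(X)\gtrsim d(X,\partial\Omega).$$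
   Context: Solutions are classical. $d(X,\partial\Omega)$ is the distance from $X$ to the boundary. A bounded domain is Lipschitz if near each boundary point, after a suitable rotation, its boundary is the graph $\{x_n=g(x')\}$ of a Lipschitz function $g$ with $[g]_{C^{0,1}}\le L$, with $L$ uniform on $\partial\Omega$; the minimal such $L$ is the Lipschitz constant $[\partial\Omega]_{C^{0,1}}$. The domain lies locally above the graph, i.e. locally $\Omega=\{x_n>g(x')\}$, and in (b1), (b2) the function $g$ describing $\partial\Omega$ near the origin is $C^1$, respectively concave. $A\gtrsim B$ means $A\ge cB$ for a positive constant $c$ independent of $X$, and $A\sim B$ means $A\gtrsim B$ and $B\gtrsim A$. *)

(* Defs.v *)
(* MathComp-Analysis, over an arbitrary realType R. *)
From HB Require Import structures.
From mathcomp Require Import all_boot all_order all_algebra.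
From mathcomp Require Import all_classical all_reals all_analysis.

Set Implicit Arguments.
Unset Strict Implicit.
Unset Printing Implicit Defensive.

Import Order.TTheory GRing.Theory Num.Theory.
Import numFieldNormedType.Exports.

Local Open Scope classical_set_scope.
Local Open Scope ring_scope.

(* The library norm on 'rV[R]_n is the sup norm. It induces the usual topology,
   but distances, Lipschitz constants and rotations need the Euclidean norm. *)
Definition enorm (R : realType) (n : nat) (x : 'rV[R]_n) : R :=
  Num.sqrt (\sum_(i < n) x 0 i ^+ 2).

Definition eball (R : realType) (n : nat) (P : 'rV[R]_n) (r : R) :
    set 'rV[R]_n :=
  [set X | enorm (X - P) < r].

Definition boundary (T : topologicalType) (A : set T) : set T :=
  closure A `\` interior A.

Definition dist (R : realType) (n : nat) (X : 'rV[R]_n) (A : set 'rV[R]_n) : R :=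
  inf [set enorm (X - Y) | Y in A].

(* Meant for 0 < a <= 1; on a bounded set of positive diameter, a > 1 would not
   describe the space C^a. *)
Definition holder_on (R : realType) (n : nat) (a : R) (A : set 'rV[R]_n)
    (h : 'rV[R]_n -> R) : Prop :=
  exists C : R, forall X Y, A X -> A Y ->
    `|h X - h Y| <= C * enorm (X - Y) `^ a.

Definition locally_holder (R : realType) (n : nat) (Om : set 'rV[R]_n)
    (h : 'rV[R]_n -> R) : Prop :=
  forall K, compact K -> K `<=` Om ->
    exists a : R, 0 < a <= 1 /\ holder_on a K h.

Definition partial (R : realType) (n : nat) (i : 'I_n) (h : 'rV[R]_n -> R) :
    'rV[R]_n -> R :=
  'D_(delta_mx 0 i) h.

(* For A open, C1_on A and C2_on A are the usual C^1(A) and C^2(A). *)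
Definition C1_on (R : realType) (n : nat) (A : set 'rV[R]_n)
    (h : 'rV[R]_n -> R) : Prop :=
  forall X, A X ->
    {for X, continuous h} /\
    forall i : 'I_n, derivable h X (delta_mx 0 i) /\
                     {for X, continuous (partial i h)}.

Definition C2_on (R : realType) (n : nat) (A : set 'rV[R]_n)
    (h : 'rV[R]_n -> R) : Prop :=
  C1_on A h /\ forall i : 'I_n, C1_on A (partial i h).

Definition laplacian (R : realType) (n : nat) (h : 'rV[R]_n -> R)
    (X : 'rV[R]_n) : R :=
  \sum_(i < n) partial i (partial i h) X.

(* Since u^(-gamma) must make sense, u is positive inside the domain. This has
   to be said explicitly, because 0 `^ (- gamma) = 0 in the library. *)
Definition solution (R : realType) (n : nat) (gamma : R) (Om : set 'rV[R]_n)
    (f u : 'rV[R]_n -> R) : Prop :=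
  [/\ C2_on Om u,
      {within closure Om, continuous u},
      forall X, Om X -> 0 < u X,
      forall X, Om X -> - laplacian u X = f X * u X `^ (- gamma) &
      forall X, boundary Om X -> u X = 0].

(* Near P, in the coordinates y = (X - P) Q with Q orthogonal, Om lies above the
   graph y_n = g(y') and boundary Om is that graph; y' is col' ord_max y. The
   function g matters only on the ball of radius r of R^(n-1), and reg r g is
   the regularity required of it there. *)
Definition graph_near (R : realType) (m : nat) (Om : set 'rV[R]_m.+1)
    (P : 'rV[R]_m.+1) (reg : R -> ('rV[R]_m -> R) -> Prop) : Prop :=
  exists (Q : 'M[R]_m.+1) (r : R) (g : 'rV[R]_m -> R),
    [/\ Q *m Q^T = 1%:M, 0 < r, reg r g &
        forall X, eball P r X ->
          let y := (X - P) *m Q in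
          (Om X <-> g (col' ord_max y) < y 0 ord_max) /\
          (boundary Om X <-> y 0 ord_max = g (col' ord_max y))].

Definition lipschitz_graph (R : realType) (m : nat) (L r : R)
    (g : 'rV[R]_m -> R) : Prop :=
  forall x y, eball 0 r x -> eball 0 r y -> `|g x - g y| <= L * enorm (x - y).

Definition C1_graph (R : realType) (m : nat) (r : R) (g : 'rV[R]_m -> R) : Prop :=
  C1_on (eball 0 r) g.

Definition concave_graph (R : realType) (m : nat) (r : R) (g : 'rV[R]_m -> R) :
    Prop :=
  convex_function (eball 0 r) (fun x => - g x).

Definition lipschitz_with (R : realType) (m : nat) (Om : set 'rV[R]_m.+1)
    (L : R) : Prop :=
  0 <= L /\ forall P, boundary Om P -> graph_near Om P (lipschitz_graph L).

(* The constant [bd Om]_{C^{0,1}}. It is an infimum because a least L need not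
   exist: for a C^1 domain every L > 0 works, but L = 0 does not in general. *)
Definition lip_const (R : realType) (m : nat) (Om : set 'rV[R]_m.+1) : R :=
  inf [set L | lipschitz_with Om L].

Definition bounded_lipschitz_domain (R : realType) (m : nat)
    (Om : set 'rV[R]_m.+1) : Prop :=
  [/\ Om !=set0, open Om, connected Om, bounded_set Om &
      exists L, lipschitz_with Om L].

Definition C1_domain (R : realType) (m : nat) (Om : set 'rV[R]_m.+1) : Prop :=
  forall P, boundary Om P -> graph_near Om P (@C1_graph R m).

Definition gtrsim (R : realType) (T : Type) (D : set T) (A B : T -> R) : Prop :=
  exists c : R, 0 < c /\ forall X, D X -> c * B X <= A X.

Definition asymp (R : realType) (T : Type) (D : set T) (A B : T -> R) : Prop :=
  gtrsim D A B /\ gtrsim D B A.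

(* Main.v *)
Require Import Defs.
From HB Require Import structures.
From mathcomp Require Import all_boot all_order all_algebra.
From mathcomp Require Import all_classical all_reals all_analysis.
From mathcomp Require Import ring lra.

Set Implicit Arguments.
Unset Strict Implicit.
Unset Printing Implicit Defensive.

Import Order.TTheory GRing.Theory Num.Theory.
Import numFieldNormedType.Exports.

Local Open Scope classical_set_scope.
Local Open Scope ring_scope.

(** The right-hand side of the equation decreases in [u].  So where a subsolution
    [v] exceeds [u], the Laplacian of [v - u] is positive, which excludes a positive
    interior maximum of [v - u]; likewise for supersolutions.  With this comparison
    principle (comparison_sub, comparison_super), the estimates of [u] by powers of
    the distance [d] to the boundary reduce to explicit barriers.  The equation is
    invariant under a scaling in which [u] has degree [2 / (1 + gamma)].

    Lower bounds.  A paraboloid in a ball inside the domain gives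
    [u >= c d ^ (2 / (1 + gamma))] (ball_lower_bound).  For [gamma < 1] this is
    improved at boundary points where the domain contains a cone: if the cone is
    nearly a half-space, it carries a positive homogeneous subharmonic function of
    any given degree [alpha > 1] (cone_lower_bound), and if it is a half-space one
    can take the degree [1] (halfspace_lower_bound).  A [C^1] graph provides the
    former cones (C1_graph_flat); a domain above a concave graph has a locally
    convex complement and contains half-balls (concave_interior_halfspace).

    Upper bounds.  If the domain near a boundary point [P] lies in a cone with
    apex [P], then [u X <= C |X - P| ^ beta] as soon as the cone carries a
    homogeneous supersolution of degree [beta] and [beta <= 2 / (1 + gamma)]
    (barrier_upper_bound).  For an arbitrary cone some small [beta] is possible
    (cone_barrier_lipschitz), which covers Lipschitz domains.  For cones close to
    a half-space any [beta < 1] is possible (cone_barrier_flat), in particular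
    [2 / (1 + gamma)] when [gamma > 1]; this covers [C^1] domains by the flatness
    of the boundary at small scales, and convex domains by supporting hyperplanes
    at nearest boundary points (convex_supporting).

    Hölder continuity.  Decay of degree [beta] towards each boundary point, with a
    uniform constant, implies Hölder continuity of exponent [beta] on the closed
    domain, by doubling the variables (holder_of_boundary_decay).  The uniform
    constants come from the compactness of the boundary. *)


(** * Second derivatives along coordinate lines *)

Lemma near_norm (R : realType) (V : normedModType R) (x : V) (P : V -> Prop) :
  (\forall y \near x, P y) ->
  exists2 e : R, 0 < e & forall y, `|y - x| < e -> P y.
Proof.
move=> h; have : nbhs x P by [].
case/nbhs_ballP => e /= e0 he; exists e => // y ye; apply: he.
by rewrite -ball_normE /= distrC.
Qed.

(** Stated at a point, since barriers are smooth only away from an apex or from a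
    lateral boundary. *)
Definition jet (R : realType) (phi : R -> R) (a b : R) : Prop :=
  exists phi1 : R -> R,
    [/\ \forall s \near 0, is_derive s (1 : R) phi (phi1 s),
        phi1 0 = a & is_derive (0 : R) (1 : R) phi1 b].

Lemma jet_eq (R : realType) (phi : R -> R) (a b a' b' : R) :
  jet phi a b -> a = a' -> b = b' -> jet phi a' b'.
Proof. by move=> h <- <-. Qed.

Lemma is_derive_comp1 (R : realType) (phi F : R -> R) (s a b : R) :
  is_derive s 1 phi a -> is_derive (phi s) 1 F b ->
  is_derive s 1 (fun x => F (phi x)) (b * a).
Proof.
move=> [d1 e1] [d2 e2]; apply: DeriveDef.
  apply/derivable1_diffP.
  apply: (@differentiable_comp R R R R phi F).
    exact: (derivable1_diffP phi s).1.
  exact: (derivable1_diffP F (phi s)).1.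
by rewrite -derive1E (derive1_comp d1 d2) !derive1E e1 e2.
Qed.

Lemma jet_near (R : realType) (phi psi : R -> R) (a b : R) :
  (\forall s \near 0, phi s = psi s) -> jet phi a b -> jet psi a b.
Proof.
move=> E [p [h1 h2 h3]]; exists p; split=> //.
have /= E2 := near_join E.
near=> s; apply: (@near_eq_is_derive _ _ _ phi psi) => //.
  by near: s.
by near: s.
Unshelve. all: by end_near. Qed.

Lemma jet_cst (R : realType) (c : R) : jet (fun=> c) 0 0.
Proof.
exists (fun=> 0); split => //; last exact: is_derive_cst.
by near=> s; exact: is_derive_cst.
Unshelve. all: by end_near. Qed.

Lemma jet_id (R : realType) (x c : R) : jet (fun s => x + s * c) c 0.
Proof.
exists (fun=> c); split => //; last exact: is_derive_cst.
near=> s.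
have := is_deriveD (is_derive_cst x s 1)
  (is_deriveM (is_derive_id s (1:R)) (is_derive_cst c s 1)).
move/(is_derive_eq); apply.
by rewrite scaler0 !add0r [_ *: _]mulr1.
Unshelve. all: by end_near. Qed.

Lemma jet_add (R : realType) (phi psi : R -> R) (a b c d : R) :
  jet phi a b -> jet psi c d -> jet (fun s => phi s + psi s) (a + c) (b + d).
Proof.
move=> [p [p1 p2 p3]] [q [q1 q2 q3]]; exists (fun s => p s + q s); split.
- by near=> s; apply: is_deriveD; near: s.
- by rewrite p2 q2.
- exact: is_deriveD.
Unshelve. all: by end_near. Qed.

Lemma jet_mul (R : realType) (phi psi : R -> R) (a b c d : R) :
  jet phi a b -> jet psi c d ->
  jet (fun s => phi s * psi s) (phi 0 * c + psi 0 * a)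
    (phi 0 * d + 2 * (a * c) + psi 0 * b).
Proof.
move=> [p [p1 p2 p3]] [q [q1 q2 q3]].
exists (fun s => phi s * q s + psi s * p s); split.
- by near=> s; apply: is_deriveM; near: s.
- by rewrite p2 q2.
- have h1 := nbhs_singleton p1; have h2 := nbhs_singleton q1.
  have := is_deriveD (is_deriveM h1 q3) (is_deriveM h2 p3).
  move/(is_derive_eq); apply.
  rewrite /GRing.scale /= p2 q2; ring.
Unshelve. all: by end_near. Qed.

Lemma jet_scale (R : realType) (k : R) (phi : R -> R) (a b : R) :
  jet phi a b -> jet (fun s => k * phi s) (k * a) (k * b).
Proof.
move=> h; apply: (jet_eq (jet_mul (jet_cst k) h)); ring.
Qed.

Lemma jet_continuous (R : realType) (phi : R -> R) (a b : R) :
  jet phi a b -> {for 0, continuous phi}.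
Proof.
move=> [p [p1 _ _]]; have [d _] := nbhs_singleton p1.
exact/differentiable_continuous/derivable1_diffP.
Qed.

Lemma jet_powR (R : realType) (phi : R -> R) (a b p : R) :
  0 < phi 0 -> jet phi a b ->
  jet (fun s => phi s `^ p) (p * phi 0 `^ (p - 1) * a)
    (p * (p - 1) * phi 0 `^ (p - 2) * a ^+ 2 + p * phi 0 `^ (p - 1) * b).
Proof.
move=> f0 h; have cf := jet_continuous h.
have pos : \forall s \near 0, 0 < phi s.
  by have := cf _ (lt_nbhsr f0).
case: h => q [q1 q2 q3].
exists (fun s => p * phi s `^ (p - 1) * q s); split.
- near=> s; apply: (is_derive_comp1 (F := fun x => x `^ p)).
    by near: s.
  by apply: is_derive1_powR; near: s.
- by rewrite q2.
- have h1 := nbhs_singleton q1.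
  have h2 := is_derive_comp1 h1 (is_derive1_powR (p - 1) f0).
  have h3 := is_deriveM (is_deriveM (is_derive_cst p (0:R) 1) h2) q3.
  apply: (is_derive_eq h3).
  rewrite /GRing.scale /= q2 mulr0 addr0 -addrA.
  rewrite (_ : - (1 : R) - 1 = - 2); last by ring.
  rewrite -[((_ * _)%R : _ -> _) 0]/(p * phi 0 `^ (p - 1)).
  ring.
Unshelve. all: by end_near. Qed.

(** The second derivative test.  If [b] were positive, the first derivative,
    which vanishes at the maximum, would be positive just to its right. *)
Lemma jet_max (R : realType) (phi : R -> R) (a b : R) :
  jet phi a b -> (\forall s \near 0, phi s <= phi 0) -> b <= 0.
Proof.
move=> [p [p1 p2 p3]] mx; rewrite leNgt; apply/negP => b0.
have p00 : p 0 = 0.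
  have [e e0 he] := near_norm (filterI p1 mx).
  have hin t : t \in `](- e), e[ -> `|t - 0| < e.
    by rewrite in_itv /= subr0 ltr_norml.
  have d0 : is_derive (0:R) 1 phi 0.
    apply: (@derive1_at_max R phi (- e) e 0).
    - by rewrite ge0_cp // ltW.
    - by move=> t /hin /he [] [].
    - by rewrite in_itv /= oppr_lt0 e0.
    - by move=> t /hin /he [].
  by have [_ <-] := nbhs_singleton p1; have [_] := d0.
have pos : \forall s \near (0:R)^'+, 0 < p s.
  case: p3 => d3 e3.
  have : (fun h => h^-1 *: (p (h *: (1:R) + 0) - p 0)) @ (0:R)^' --> b.
    by rewrite -e3.
  move=> hc; have := hc _ (lt_nbhsr b0); rewrite /= => hh.
  have : \forall s \near (0:R)^'+, 0 < s^-1 *: (p (s *: (1:R) + 0) - p 0).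
    move: hh; rewrite /nbhs /= /dnbhs /at_right /within /=.
    apply: filterS => s hs s0; apply: hs; exact: lt0r_neq0.
  move=> hs; near=> s.
  have s0 : 0 < s by near: s; exact: nbhs_right_gt.
  have : 0 < s^-1 *: (p (s *: (1:R) + 0) - p 0) by near: s.
  rewrite p00 subr0 addr0 [s *: _]mulr1 [_ *: _]/(_ * _).
  by rewrite pmulr_rgt0 // invr_gt0.
have [e e0 he] : exists2 e : R, 0 < e & forall s, 0 < s < e ->
   [/\ 0 < p s, is_derive s 1 phi (p s) & phi s <= phi 0].
  have [e1 e10 h1] := near_norm (filterI p1 mx).
  have [e2 e20 h2] := near_norm (pos : \forall s \near (0:R), 0 < s -> 0 < p s).
  exists (Order.min e1 e2); first by rewrite lt_min e10.
  move=> s /andP[s0]; rewrite lt_min => /andP[s1 s2].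
  have [] := h1 s; first by rewrite subr0 gtr0_norm.
  move=> d1 d2; split => //; apply: h2 => //.
  by rewrite subr0 gtr0_norm.
have e20 : 0 < e / 2 by lra.
have := @MVT R phi p 0 (e / 2) e20.
case.
- by move=> x; rewrite in_itv /= => /andP[x0 x1]; have [|] := he x; first lra.
- apply: derivable_within_continuous => x; rewrite in_itv /= => /andP[x0 x1].
  have [->|xn0] := eqVneq x 0; first by case: (nbhs_singleton p1).
  have xp : 0 < x by rewrite lt_neqAle eq_sym xn0.
  by have [|_ [? _] _] := he x; first lra.
- move=> c; rewrite in_itv /= => /andP[c0 c1] E.
  have [|pc _ _] := he c; first lra.
  have [|_ _ le] := he (e / 2); first lra.
  have : 0 < p c * (e / 2 - 0) by rewrite subr0 mulr_gt0.
  by rewrite -E subr_gt0 ltNge le.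
Unshelve. all: by end_near. Qed.

(** * Euclidean geometry of row vectors *)

Definition dotv (R : realType) (n : nat) (x y : 'rV[R]_n) : R :=
  \sum_(i < n) x 0 i * y 0 i.

Lemma dotvC (R : realType) n (x y : 'rV[R]_n) : dotv x y = dotv y x.
Proof. by apply: eq_bigr => i _; rewrite mulrC. Qed.

Lemma dotvDl (R : realType) n (x y z : 'rV[R]_n) :
  dotv (x + y) z = dotv x z + dotv y z.
Proof. by rewrite -big_split; apply: eq_bigr => i _; rewrite mxE mulrDl. Qed.

Lemma dotvZl (R : realType) n k (x z : 'rV[R]_n) :
  dotv (k *: x) z = k * dotv x z.
Proof. by rewrite /dotv mulr_sumr; apply: eq_bigr => i _; rewrite mxE mulrA. Qed.

Lemma dotvNl (R : realType) n (x z : 'rV[R]_n) : dotv (- x) z = - dotv x z.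
Proof. by rewrite -scaleN1r dotvZl mulN1r. Qed.

Lemma dotvDr (R : realType) n (x y z : 'rV[R]_n) :
  dotv z (x + y) = dotv z x + dotv z y.
Proof. by rewrite dotvC dotvDl !(dotvC z). Qed.

Lemma dotvZr (R : realType) n k (x z : 'rV[R]_n) :
  dotv z (k *: x) = k * dotv z x.
Proof. by rewrite dotvC dotvZl (dotvC z). Qed.

Lemma dotvNr (R : realType) n (x z : 'rV[R]_n) : dotv z (- x) = - dotv z x.
Proof. by rewrite dotvC dotvNl (dotvC z). Qed.

Definition dotvE := (dotvDl, dotvDr, dotvNl, dotvNr, dotvZl, dotvZr).

Lemma dotv0r (R : realType) n (x : 'rV[R]_n) : dotv x 0 = 0.
Proof. by rewrite /dotv big1 // => i _; rewrite mxE mulr0. Qed.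

Lemma dotv_delta (R : realType) n (x : 'rV[R]_n) i :
  dotv x (delta_mx 0 i) = x 0 i.
Proof.
rewrite /dotv (bigD1 i) //= big1; last first.
  by move=> j ji; rewrite !mxE (negbTE ji) andbF mulr0.
by rewrite !mxE !eqxx mulr1 addr0.
Qed.

Lemma dotv_ge0 (R : realType) n (x : 'rV[R]_n) : 0 <= dotv x x.
Proof. by apply: sumr_ge0 => i _; rewrite -expr2 sqr_ge0. Qed.

Lemma enormE (R : realType) n (x : 'rV[R]_n) : enorm x = Num.sqrt (dotv x x).
Proof. by []. Qed.

Lemma enorm_ge0 (R : realType) n (x : 'rV[R]_n) : 0 <= enorm x.
Proof. exact: sqrtr_ge0. Qed.

Lemma enorm_sqr (R : realType) n (x : 'rV[R]_n) : enorm x ^+ 2 = dotv x x.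
Proof. by rewrite enormE sqr_sqrtr // dotv_ge0. Qed.

Lemma enormZ (R : realType) n k (x : 'rV[R]_n) : enorm (k *: x) = `|k| * enorm x.
Proof.
rewrite enormE dotvZl dotvZr mulrA -expr2 sqrtrM ?sqr_ge0 //.
by rewrite sqrtr_sqr.
Qed.

Lemma enormN (R : realType) n (x : 'rV[R]_n) : enorm (- x) = enorm x.
Proof. by rewrite -scaleN1r enormZ normrN1 mul1r. Qed.

Lemma enormC (R : realType) n (x y : 'rV[R]_n) : enorm (x - y) = enorm (y - x).
Proof. by rewrite -enormN opprB. Qed.

Lemma enorm0 (R : realType) n : enorm (0 : 'rV[R]_n) = 0.
Proof. by rewrite enormE dotv0r sqrtr0. Qed.

Lemma le_coord_enorm (R : realType) n (x : 'rV[R]_n) i : `|x 0 i| <= enorm x.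
Proof.
rewrite -sqrtr_sqr enormE ler_wsqrtr // /dotv (bigD1 i) //= -expr2.
by rewrite lerDl; apply: sumr_ge0 => j _; rewrite -expr2 sqr_ge0.
Qed.

Lemma enorm_eq0 (R : realType) n (x : 'rV[R]_n) : enorm x = 0 -> x = 0.
Proof.
move=> x0; apply/rowP => i; rewrite mxE; apply/eqP; rewrite -normr_le0 -x0.
exact: le_coord_enorm.
Qed.

Lemma enorm_gt0 (R : realType) n (x : 'rV[R]_n) : x != 0 -> 0 < enorm x.
Proof.
move=> x0; rewrite lt_neqAle enorm_ge0 andbT eq_sym; apply: contraNneq x0.
by move/enorm_eq0 => ->.
Qed.

Lemma cauchy_schwarz (R : realType) n (x y : 'rV[R]_n) :
  dotv x y <= enorm x * enorm y.
Proof.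
have [->|x0] := eqVneq x 0; first by rewrite dotvC dotv0r enorm0 mul0r.
have [->|y0] := eqVneq y 0; first by rewrite dotv0r enorm0 mulr0.
have := dotv_ge0 (enorm y *: x - enorm x *: y).
rewrite !dotvE -!enorm_sqr (dotvC y x) => h.
have xy : 0 < enorm x * enorm y by rewrite mulr_gt0 ?enorm_gt0.
rewrite -(ler_pM2l xy); nra.
Qed.

Lemma cauchy_schwarz_abs (R : realType) n (x y : 'rV[R]_n) :
  `|dotv x y| <= enorm x * enorm y.
Proof.
rewrite ler_norml cauchy_schwarz andbT lerNl -dotvNl -(enormN x).
exact: cauchy_schwarz.
Qed.

Lemma le_enorm_sqr (R : realType) n (x : 'rV[R]_n) (r : R) :
  0 <= r -> (enorm x <= r) = (dotv x x <= r ^+ 2).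
Proof. by move=> r0; rewrite -enorm_sqr ler_pXn2r ?nnegrE ?enorm_ge0. Qed.

Lemma lt_enorm_sqr (R : realType) n (x : 'rV[R]_n) (r : R) :
  0 <= r -> (enorm x < r) = (dotv x x < r ^+ 2).
Proof. by move=> r0; rewrite -enorm_sqr ltr_pXn2r ?nnegrE ?enorm_ge0. Qed.

Lemma enormD (R : realType) n (x y : 'rV[R]_n) :
  enorm (x + y) <= enorm x + enorm y.
Proof.
rewrite le_enorm_sqr ?addr_ge0 ?enorm_ge0 // !dotvE (dotvC y x).
rewrite sqrrD !enorm_sqr; have := cauchy_schwarz x y; lra.
Qed.

Lemma enorm_dist (R : realType) n (x y z : 'rV[R]_n) :
  enorm (x - z) <= enorm (x - y) + enorm (y - z).
Proof. by rewrite -[x - z](subrKA y) enormD. Qed.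

Lemma enorm_sum (R : realType) n (x : 'rV[R]_n) :
  enorm x <= \sum_(i < n) `|x 0 i|.
Proof.
have s0 : 0 <= \sum_(i < n) `|x 0 i| by apply: sumr_ge0.
rewrite le_enorm_sqr // expr2 mulr_suml; apply: ler_sum => i _.
rewrite (le_trans (ler_norm _)) // normrM ler_wpM2l // (bigD1 i) //= lerDl.
exact: sumr_ge0.
Qed.

Lemma normr_le_enorm (R : realType) n (x : 'rV[R]_n) : `|x| <= enorm x.
Proof.
rewrite [leLHS]/Num.norm /= mx_normrE; apply/bigmax_leP; split.
  exact: enorm_ge0.
by move=> [i j] _ /=; rewrite ord1 le_coord_enorm.
Qed.

Lemma le_coord_normr (R : realType) n (x : 'rV[R]_n) i : `|x 0 i| <= `|x|.
Proof.
by rewrite [leRHS]/Num.norm /= mx_normrE; apply/bigmax_geP; right; exists (0, i).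
Qed.

Lemma enorm_le_normr (R : realType) n (x : 'rV[R]_n) :
  enorm x <= n%:R * `|x|.
Proof.
apply: le_trans (enorm_sum x) _.
apply: le_trans (ler_sum _ (fun i _ => le_coord_normr x i)) _.
by rewrite sumr_const card_ord mulr_natl.
Qed.

Lemma near_eball (R : realType) n (P : 'rV[R]_n) (S : 'rV[R]_n -> Prop) :
  (\forall Y \near P, S Y) <->
  exists2 e : R, 0 < e & forall Y, eball P e Y -> S Y.
Proof.
split.
  case/near_norm => e e0 he; exists e => // Y YP; apply: he.
  exact: le_lt_trans (normr_le_enorm _) YP.
move=> [e e0 he].
have d0 : 0 < e / n.+1%:R by rewrite divr_gt0.
have : nbhs P (ball P (e / n.+1%:R)) by exact: nbhsx_ballx.
apply: filterS => Y; rewrite -ball_normE /= => PY; apply: he; rewrite /eball /=.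
apply: le_lt_trans (enorm_le_normr _) _.
rewrite distrC; move: PY; rewrite ltr_pdivlMr // mulrC.
by apply: le_lt_trans; rewrite ler_wpM2r // ler_nat.
Qed.

Lemma continuous_eball (R : realType) n (h : 'rV[R]_n -> R) (X : 'rV[R]_n) :
  (forall e : R, 0 < e -> exists2 d : R, 0 < d &
     forall Y, eball X d Y -> `|h X - h Y| < e) ->
  {for X, continuous h}.
Proof.
move=> H; apply/(@cvgrPdist_lt _ _ _ (nbhs X)) => e e0.
exact/near_eball/H.
Qed.

Lemma enorm_continuous (R : realType) n (P : 'rV[R]_n) :
  continuous (fun Y : 'rV[R]_n => enorm (Y - P)).
Proof.
move=> X; apply: continuous_eball => e e0; exists e => // Y XY.
apply: le_lt_trans XY; rewrite ler_norml.
have := enorm_dist X Y P; have := enorm_dist Y X P; rewrite (enormC X Y).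
move=> h1 h2; apply/andP; split; lra.
Qed.

Lemma dotv_continuous (R : realType) n (v P : 'rV[R]_n) :
  continuous (fun Y : 'rV[R]_n => dotv v (Y - P)).
Proof.
move=> X; apply: continuous_eball => e e0.
have v1 : 0 < enorm v + 1 by rewrite ltr_pwDr ?enorm_ge0.
exists (e / (enorm v + 1)); first by rewrite divr_gt0.
move=> Y; rewrite /eball /= ltr_pdivlMr // => XY.
rewrite -[_ - _](_ : dotv v (X - Y) = _); last by rewrite !dotvE; ring.
apply: le_lt_trans (cauchy_schwarz_abs _ _) _.
by rewrite mulrC enormC (le_lt_trans _ XY) // ler_wpM2l ?enorm_ge0 // lerDl.
Qed.

Lemma enorm_delta (R : realType) n (i : 'I_n) :
  enorm (delta_mx 0 i : 'rV[R]_n) = 1.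
Proof.
rewrite enormE /dotv (bigD1 i) //= big1; last first.
  by move=> j ji; rewrite !mxE (negbTE ji) andbF mulr0.
by rewrite !mxE !eqxx mulr1 addr0 sqrtr1.
Qed.

Lemma eball_center (R : realType) n (P : 'rV[R]_n) (r : R) :
  0 < r -> eball P r P.
Proof. by rewrite /eball /= subrr enorm0. Qed.

Lemma eball_open (R : realType) n (P : 'rV[R]_n) (r : R) : open (eball P r).
Proof.
rewrite openE => X XP; apply/near_eball; exists (r - enorm (X - P)).
  by rewrite subr_gt0.
move=> Y YX; rewrite /eball /= in YX *; apply: le_lt_trans (enorm_dist Y X P) _.
lra.
Qed.

Lemma near_in_eball (R : realType) n (X Y : 'rV[R]_n) (d : R) :
  enorm (Y - X) < d -> \forall Z \near Y, enorm (Z - X) < d.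
Proof.
move=> YX; have : nbhs Y (eball X d).
  by apply: open_nbhs_nbhs; split; [exact: eball_open|exact: YX].
by [].
Qed.

Lemma orthogonal_enorm (R : realType) n (Q : 'M[R]_n) (x : 'rV[R]_n) :
  Q *m Q^T = 1%:M -> enorm (x *m Q) = enorm x.
Proof.
move=> QQ.
have dE (y : 'rV[R]_n) : dotv y y = (y *m y^T) 0 0.
  by rewrite mxE; apply: eq_bigr => i _; rewrite mxE.
by rewrite !enormE !dE trmx_mul mulmxA -(mulmxA x) QQ mulmx1.
Qed.

(** * Laplacians of explicit functions, and the maximum principle *)

(** The gradient has to be carried along with the Laplacian, since the
    Laplacians of products and powers depend on it. *)
Definition has_lap (R : realType) n (h : 'rV[R]_n -> R) (X g : 'rV[R]_n)
    (l : R) : Prop :=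
  exists H : 'I_n -> R, l = \sum_(i < n) H i /\
    forall i, jet (fun s => h (X + s *: delta_mx 0 i)) (g 0 i) (H i).

Lemma has_lap_eq (R : realType) n (h : 'rV[R]_n -> R) (X g g' : 'rV[R]_n) l l' :
  has_lap h X g l -> g = g' -> l = l' -> has_lap h X g' l'.
Proof. by move=> hh <- <-. Qed.

Lemma near_line (R : realType) n (X v : 'rV[R]_n) (S : 'rV[R]_n -> Prop) :
  (\forall Y \near X, S Y) -> \forall s \near (0 : R), S (X + s *: v).
Proof.
move/near_eball => [e e0 he].
have v1 : 0 < enorm v + 1 by rewrite ltr_pwDr ?enorm_ge0.
have d0 : 0 < e / (enorm v + 1) by rewrite divr_gt0.
have : nbhs (0 : R) (ball (0 : R) (e / (enorm v + 1))) by exact: nbhsx_ballx.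
apply: filterS => s; rewrite -ball_normE /= sub0r normrN => hs.
apply: he; rewrite /eball /= [X + _]addrC addrK enormZ.
apply: (@le_lt_trans _ _ (`|s| * (enorm v + 1))).
  by rewrite ler_wpM2l // lerDl.
by rewrite -ltr_pdivlMr.
Qed.

Lemma has_lap_near (R : realType) n (h k : 'rV[R]_n -> R) (X g : 'rV[R]_n) l :
  (\forall Y \near X, h Y = k Y) -> has_lap h X g l -> has_lap k X g l.
Proof.
move=> E [H [-> hH]]; exists H; split => // i; apply: jet_near (hH i).
exact: near_line E.
Qed.

Lemma has_lap_cst (R : realType) n c (X : 'rV[R]_n) :
  has_lap (fun=> c) X 0 0.
Proof.
exists (fun=> 0); split; first by rewrite big1.
by move=> i; rewrite mxE; exact: jet_cst.
Qed.

Lemma has_lap_add (R : realType) n (h k : 'rV[R]_n -> R) (X g g' : 'rV[R]_n) l l' :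
  has_lap h X g l -> has_lap k X g' l' ->
  has_lap (fun Y => h Y + k Y) X (g + g') (l + l').
Proof.
move=> [H [-> hH]] [K [-> hK]]; exists (fun i => H i + K i).
by split; [rewrite big_split|move=> i; rewrite mxE; exact: jet_add].
Qed.

Lemma has_lap_scale (R : realType) n k (h : 'rV[R]_n -> R) (X g : 'rV[R]_n) l :
  has_lap h X g l -> has_lap (fun Y => k * h Y) X (k *: g) (k * l).
Proof.
move=> [H [-> hH]]; exists (fun i => k * H i).
by split; [rewrite mulr_sumr|move=> i; rewrite mxE; exact: jet_scale].
Qed.

Lemma has_lap_mul (R : realType) n (h k : 'rV[R]_n -> R) (X g g' : 'rV[R]_n) l l' :
  has_lap h X g l -> has_lap k X g' l' ->
  has_lap (fun Y => h Y * k Y) X (h X *: g' + k X *: g)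
    (h X * l' + 2 * dotv g g' + k X * l).
Proof.
move=> [H [-> hH]] [K [-> hK]].
exists (fun i => h X * K i + 2 * (g 0 i * g' 0 i) + k X * H i); split.
  by rewrite !big_split /= !mulr_sumr.
move=> i; have := jet_mul (hH i) (hK i); rewrite scale0r addr0.
by move/jet_eq; apply; rewrite ?mxE.
Qed.

Lemma has_lap_powR (R : realType) n p (h : 'rV[R]_n -> R) (X g : 'rV[R]_n) l :
  0 < h X -> has_lap h X g l ->
  has_lap (fun Y => h Y `^ p) X ((p * h X `^ (p - 1)) *: g)
    (p * (p - 1) * h X `^ (p - 2) * dotv g g + p * h X `^ (p - 1) * l).
Proof.
move=> h0 [H [-> hH]].
exists (fun i => p * (p - 1) * h X `^ (p - 2) * (g 0 i) ^+ 2
                 + p * h X `^ (p - 1) * H i); split.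
  by rewrite !big_split /= !mulr_sumr.
move=> i; have h0' : 0 < h (X + 0 *: delta_mx 0 i) by rewrite scale0r addr0.
have := jet_powR p h0' (hH i); rewrite scale0r addr0.
by move/jet_eq; apply; rewrite ?mxE.
Qed.

Lemma has_lap_lin (R : realType) n (v P X : 'rV[R]_n) :
  has_lap (fun Y => dotv v (Y - P)) X v 0.
Proof.
exists (fun=> 0); split; first by rewrite big1.
move=> i; have := jet_id (dotv v (X - P)) (v 0 i); congr jet.
apply/funext => s; rewrite [in RHS]addrAC [RHS]dotvDr dotvZr; congr (_ + s * _).
by rewrite dotv_delta.
Qed.

Lemma has_lap_sq (R : realType) n (P X : 'rV[R]_n) :
  has_lap (fun Y => dotv (Y - P) (Y - P)) X (2 *: (X - P)) (2 * n%:R).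
Proof.
exists (fun=> 2); split.
  by rewrite sumr_const card_ord [2 * _]mulr_natr.
move=> i.
have j1 := jet_add (jet_cst (dotv (X - P) (X - P) - ((X - P) 0 i) ^+ 2))
  (jet_mul (jet_id ((X - P) 0 i) 1) (jet_id ((X - P) 0 i) 1)).
have {j1} := jet_eq j1 erefl erefl; rewrite mul0r addr0 => j1.
have : jet (fun s => dotv (X + s *: delta_mx 0 i - P) (X + s *: delta_mx 0 i - P))
   (0 + ((X - P) 0 i * 1 + (X - P) 0 i * 1))
   (0 + ((X - P) 0 i * 0 + 2 * (1 * 1) + (X - P) 0 i * 0)).
  move: j1; congr jet; apply/funext => s.
  rewrite (addrAC X); move: (X - P) => Z.
  rewrite !dotvE (dotvC _ Z) !dotv_delta mxE !eqxx /=; ring.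
by move/jet_eq; apply; rewrite ?mxE; ring.
Qed.

Lemma line_is_derive (R : realType) n (h : 'rV[R]_n -> R) (X v : 'rV[R]_n) (s : R) :
  derivable h (X + s *: v) v ->
  is_derive s 1 (fun t => h (X + t *: v)) ('D_v h (X + s *: v)).
Proof.
move=> d.
have E : (fun k : R => k^-1 *: (h (k *: v + (X + s *: v)) - h (X + s *: v)))
  = (fun k : R => k^-1 *: ((fun t => h (X + t *: v)) (k *: (1 : R) + s)
       - (fun t => h (X + t *: v)) s)).
  apply/funext => k /=; congr (_ *: (h _ - _)).
  by rewrite addrCA [k *: (1 : R)]mulr1 scalerDl.
split; first by rewrite /derivable -E; exact: d.
by rewrite /derive -E.
Qed.

Lemma C2_on_jet (R : realType) n (Om : set 'rV[R]_n) u X i :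
  open Om -> C2_on Om u -> Om X ->
  jet (fun s => u (X + s *: delta_mx 0 i)) (partial i u X)
    (partial i (partial i u) X).
Proof.
move=> oO [c1 c2] OX; exists (fun s => partial i u (X + s *: delta_mx 0 i)); split.
- have : \forall Y \near X, Om Y by exact: open_nbhs_nbhs.
  move/(near_line (delta_mx 0 i)); apply: filterS => s Os.
  by apply: line_is_derive; case: (c1 _ Os) => _ /(_ i)[].
- by rewrite scale0r addr0.
- have := @line_is_derive R n (partial i u) X (delta_mx 0 i) 0.
  rewrite scale0r addr0; apply.
  by case: (c2 i _ OX) => _ /(_ i)[].
Qed.

Lemma C2_on_has_lap (R : realType) n (Om : set 'rV[R]_n) u X :
  open Om -> C2_on Om u -> Om X ->
  has_lap u X (\row_i partial i u X) (laplacian u X).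
Proof.
move=> oO c OX; exists (fun i => partial i (partial i u) X); split => // i.
by rewrite mxE; exact: C2_on_jet c OX.
Qed.

Lemma has_lap_max (R : realType) n (h : 'rV[R]_n -> R) (X g : 'rV[R]_n) l :
  has_lap h X g l -> (\forall Y \near X, h Y <= h X) -> l <= 0.
Proof.
move=> [H [-> hH]] mx; apply: sumr_le0 => i _; apply: jet_max (hH i) _.
by rewrite scale0r addr0; exact: near_line mx.
Qed.

(** The equation enters only through the sign of the Laplacian where [h] is
    positive; this is what makes the principle fit the singular nonlinearity. *)
Lemma max_principle (R : realType) n (K : set 'rV[R]_n) (h : 'rV[R]_n -> R) :
  compact K -> {within K, continuous h} ->
  (forall X, K X -> 0 < h X ->
    nbhs X K /\ exists g l, has_lap h X g l /\ 0 < l) ->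
  forall X, K X -> h X <= 0.
Proof.
move=> cK ch hint X KX; rewrite leNgt; apply/negP => hX.
have [|C] := @EVT_max_rV R n h K _ cK ch; first by exists X.
rewrite inE => KC mC.
have hC : 0 < h C by apply: lt_le_trans hX (mC _ _); rewrite inE.
have [nC [g [l [hl l0]]]] := hint C KC hC.
suff : l <= 0 by rewrite leNgt l0.
by apply: has_lap_max hl _; apply: filterS nC => Y KY; apply: mC; rewrite inE.
Qed.

(** * Real powers *)

Lemma powR_le_base (R : realType) (r x y : R) :
  0 <= r -> 0 <= x -> x <= y -> x `^ r <= y `^ r.
Proof.
move=> r0 x0 xy; apply: ge0_ler_powR => //; rewrite nnegrE //.
exact: le_trans x0 xy.
Qed.

Lemma powR_le_baseN (R : realType) (r x y : R) :
  0 <= r -> 0 < x -> x <= y -> y `^ (- r) <= x `^ (- r).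
Proof.
move=> r0 x0 xy; have y0 := lt_le_trans x0 xy.
by rewrite !powRN lef_pV2 ?posrE ?powR_gt0 // powR_le_base // ltW.
Qed.

Lemma powRD_gt0 (R : realType) (x r s : R) :
  0 < x -> x `^ (r + s) = x `^ r * x `^ s.
Proof. by move=> x0; rewrite powRD //; apply/implyP => _; exact: lt0r_neq0. Qed.

Lemma powR_lt_base (R : realType) (r x y : R) :
  0 < r -> 0 <= x -> x < y -> x `^ r < y `^ r.
Proof.
move=> r0 x0 xy; apply: gt0_ltr_powR => //; rewrite nnegrE //.
exact: le_trans x0 (ltW xy).
Qed.

Lemma powR_continuous (R : realType) (p x : R) :
  0 < x -> {for x, continuous (fun t : R => t `^ p)}.
Proof.
move=> x0; have [d _] := is_derive1_powR p x0.
exact/differentiable_continuous/derivable1_diffP.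
Qed.

(** Truncation at zero is needed since the power of a negative number is not
    small when that number is. *)
Lemma powR_max_continuous (R : realType) (p : R) :
  0 < p -> continuous (fun t : R => Num.max t 0 `^ p).
Proof.
move=> p0 x; apply/cvgrPdist_lt => e e0.
have [x0|x0|x0] := ltgtP x 0.
- near=> t; have t0 : t < 0 by near: t; exact: lt_nbhsl.
  by rewrite !max_r ?(ltW x0) ?(ltW t0) // subrr normr0.
- have /cvgrPdist_lt/(_ e e0) h := @powR_continuous _ p _ x0.
  near=> t; have t0 : 0 < t by near: t; exact: lt_nbhsr.
  by rewrite !max_l ?(ltW x0) ?(ltW t0) //; near: t.
- rewrite x0 powR0 ?gt_eqF //.
  have ep : 0 < e `^ p^-1 by rewrite powR_gt0.
  near=> t; rewrite sub0r normrN ger0_norm ?powR_ge0 //.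
  have te : Num.max t 0 < e `^ p^-1.
    by rewrite gt_max ep andbT; near: t; exact: lt_nbhsl.
  apply: lt_le_trans (powR_lt_base p0 _ te) _.
    by rewrite le_max lexx orbT.
  by rewrite -powRrM mulVf ?gt_eqF // powRr1 // ltW.
Unshelve. all: by end_near. Qed.

Lemma sqr_powR_half (R : realType) (x p : R) : (x ^+ 2) `^ (p / 2) = `|x| `^ p.
Proof.
rewrite -real_normK ?num_real // -powR_mulrn // -powRrM.
by congr (_ `^ _); field.
Qed.

(** * Bounded domains and their boundaries *)

Lemma closure_boundary (T : topologicalType) (A : set T) X :
  open A -> closure A X -> A X \/ boundary A X.
Proof.
move=> oA cX; have [AX|nAX] := pselect (A X); [by left|right; split => //].
by move/interior_subset.
Qed.

Lemma boundary_notin (T : topologicalType) (A : set T) X :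
  open A -> boundary A X -> ~ A X.
Proof. by move=> oA [_ nX] AX; apply: nX; rewrite ((interior_id A).1 oA). Qed.

Lemma closure_bounded (R : realType) n (A : set 'rV[R]_n) :
  bounded_set A -> exists2 M : R, 0 < M & forall X, closure A X -> enorm X <= M.
Proof.
move=> [M0 [_ hM]]; pose M := `|M0| + 1.
have AM X : A X -> `|X| <= M.
  by apply: hM; rewrite ltr_pwDr // ler_norm.
have Mp : 0 < M by rewrite ltr_wpDl.
exists (n%:R * (M + 1) + 1).
  by rewrite ltr_wpDl // mulr_ge0 // addr_ge0 // ltW.
move=> X /(_ [set Y | `|X - Y| < 1])[].
  by have := nbhsx_ballx X (1 : R) ltr01; rewrite -ball_normE.
move=> Y [/AM YM /= XY]; apply: le_trans (enorm_le_normr X) _.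
rewrite -[leLHS]addr0 lerD // ler_wpM2l //.
rewrite -(subrK Y X); apply: le_trans (ler_normD _ _) _.
by rewrite addrC lerD // ltW.
Qed.

Lemma closure_compact (R : realType) n (A : set 'rV[R]_n) :
  bounded_set A -> compact (closure A).
Proof.
move=> /closure_bounded[M M0 hM]; apply: bounded_closed_compact.
  exists M; split; first exact: num_real.
  move=> x Mx X /hM XM; apply: le_trans (normr_le_enorm X) _.
  exact: le_trans XM (ltW Mx).
exact: closed_closure.
Qed.

Lemma boundary_closed (T : topologicalType) (A : set T) : closed (boundary A).
Proof.
apply: closedI; first exact: closed_closure.
exact/open_closedC/open_interior.
Qed.

Lemma boundary_compact (R : realType) n (A : set 'rV[R]_n) :
  bounded_set A -> compact (boundary A).
Proof.
move=> bA; apply: (subclosed_compact (boundary_closed (A := A)) (closure_compact bA)).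
by move=> X [].
Qed.

Lemma within_continuous_of (T U : topologicalType) (A : set T) (f : T -> U) :
  (forall X, A X -> {for X, continuous f}) -> {within A, continuous f}.
Proof.
by move=> h; apply/subspace_continuousP => X AX; apply: cvg_within_filter; exact: h.
Qed.

Lemma solution_ge0 (R : realType) n gamma (Om : set 'rV[R]_n) f u X :
  open Om -> solution gamma Om f u -> closure Om X -> 0 <= u X.
Proof.
move=> oO [_ _ up _ u0] /(closure_boundary oO)[/up/ltW //|/u0 ->//].
Qed.

Lemma solution_bounded (R : realType) n gamma (Om : set 'rV[R]_n) f u :
  bounded_set Om -> solution gamma Om f u ->
  exists2 M : R, 0 < M & forall X, closure Om X -> u X <= M.
Proof.
move=> bO [_ cu _ _ _]; have cK := closure_compact bO.
have [M [_ hM]] := compact_bounded (continuous_compact cu cK).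
exists (`|M| + 1); first by rewrite ltr_wpDl.
move=> X cX; apply: le_trans (ler_norm _) _; apply: hM (imageP u cX).
by rewrite ltr_pwDr // ler_norm.
Qed.

(** * From boundary decay to global Hölder continuity *)

Lemma jet_opp (R : realType) (phi : R -> R) (a b : R) :
  jet phi a b -> jet (fun s => phi (- s)) (- a) b.
Proof.
move=> [p [p1 p2 p3]]; exists (fun s => - p (- s)).
have dN (s : R) : is_derive s 1 (fun t : R => - t) (-1).
  by have := is_deriveNid s (1 : R).
split.
- have cN : {for (0 : R), continuous (fun t : R => - t)}.
    exact: opp_continuous.
  have : \forall s \near (0:R), is_derive (- s : R) (1:R) phi (p (- s)).
    apply: (cN [set y | is_derive (y : R) (1:R) phi (p y)]).
    by rewrite oppr0.
  apply: filterS => s hs.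
  by have := is_derive_comp1 (dN s) hs; move/is_derive_eq; apply; rewrite mulrN1.
- by rewrite oppr0 p2.
- have h0 : is_derive (- (0:R)) 1 p b by rewrite oppr0.
  have := is_deriveN (is_derive_comp1 (dN 0) h0).
  by move/is_derive_eq; apply; rewrite mulrN1 opprK.
Qed.

(** A penalty comparable to the [a]-th power of the distance which, unlike that
    power, splits into functions of one coordinate each: its second derivatives
    along coordinate directions suffice below. *)
Definition penalty (R : realType) n (a : R) (z : 'rV[R]_n) : R :=
  \sum_(i < n) (z 0 i ^+ 2) `^ (a / 2).

Lemma penalty_le (R : realType) n (a : R) (z : 'rV[R]_n) :
  0 <= a -> penalty a z <= n%:R * enorm z `^ a.
Proof.
move=> a0; have le i : (z 0 i ^+ 2) `^ (a / 2) <= enorm z `^ a.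
  by rewrite sqr_powR_half powR_le_base // le_coord_enorm.
apply: le_trans (ler_sum _ (fun i _ => le i)) _.
by rewrite sumr_const card_ord mulr_natl.
Qed.

Lemma penalty_ge_coord (R : realType) n (a : R) (z : 'rV[R]_n) i :
  (z 0 i ^+ 2) `^ (a / 2) <= penalty a z.
Proof.
by rewrite /penalty (bigD1 i) //= lerDl sumr_ge0 // => j _; exact: powR_ge0.
Qed.

Lemma argmax_coord (R : realType) n (z : 'rV[R]_n) :
  z != 0 -> exists2 i, z 0 i != 0 & forall j, `|z 0 j| <= `|z 0 i|.
Proof.
move=> z0; have [i0 zi0] : exists i, z 0 i != 0.
  apply: contrapT => h; move/eqP: z0; apply; apply/rowP => i.
  by rewrite mxE; apply: contrapT => /eqP zi; apply: h; exists i.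
case: (@arg_maxP _ _ 'I_n i0 xpredT (fun i => `|z 0 i|)) => // i _ mi.
exists i; last by move=> j; exact: mi.
by rewrite -normr_gt0 (lt_le_trans _ (mi i0 _)) ?normr_gt0.
Qed.

Lemma penalty_ge (R : realType) n (a : R) (z : 'rV[R]_n) :
  0 < a -> enorm z `^ a <= n%:R `^ a * penalty a z.
Proof.
move=> a0; have [->|/argmax_coord[i _ mi]] := eqVneq z 0.
  rewrite enorm0 powR0 ?gt_eqF // mulr_ge0 ?powR_ge0 //.
  by apply: sumr_ge0 => i _; exact: powR_ge0.
apply: (@le_trans _ _ ((n%:R * `|z 0 i|) `^ a)).
  apply: powR_le_base; [exact: ltW|exact: enorm_ge0|].
  apply: le_trans (enorm_sum z) _.
  apply: le_trans (ler_sum _ (fun j _ => mi j)) _.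
  by rewrite sumr_const card_ord mulr_natl.
rewrite powRM // ler_wpM2l ?powR_ge0 // -sqr_powR_half.
exact: penalty_ge_coord.
Qed.

Lemma penalty_continuous (R : realType) n (a : R) :
  0 < a -> continuous (@penalty R n a).
Proof.
move=> a0.
have -> : @penalty R n a =
    (fun z => \sum_(i < n) Num.max (z 0 i ^+ 2) 0 `^ (a / 2)).
  apply/funext => z; apply: eq_bigr => i _; rewrite max_l //; exact: sqr_ge0.
move=> z; apply: (@cvg_big R _ +%R 0 _ (@add_continuous _) _ (nbhs z)) => i _.
apply: (@continuous_comp _ _ _ (fun y : 'rV[R]_n => y 0 i ^+ 2)
  (fun t : R => Num.max t 0 `^ (a / 2))).
  apply: (@continuous_comp _ _ _ (fun y : 'rV[R]_n => y 0 i) (fun t : R => t ^+ 2)).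
    exact: coord_continuous.
  exact: exprn_continuous.
by apply: powR_max_continuous; rewrite divr_gt0.
Qed.

(** A power less than one is strictly concave away from zero, and there it is
    smooth; the factor 2 is the speed at which two points separate when they move
    apart at unit speed. *)
Lemma penalty_jet (R : realType) n (a : R) (z : 'rV[R]_n) i :
  z 0 i != 0 ->
  exists d, jet (fun s => penalty a (z + (s * 2) *: delta_mx 0 i)) d
    (4 * a * (a - 1) * (z 0 i ^+ 2) `^ (a / 2 - 1)).
Proof.
move=> zi; have q0 : 0 < z 0 i ^+ 2 by rewrite exprn_even_gt0.
pose lin (s : R) := z 0 i + s * 2.
have j1 := jet_mul (jet_id (z 0 i) 2) (jet_id (z 0 i) 2).
have {j1} : jet (fun s => (lin s) ^+ 2) (4 * z 0 i) 8.
  have -> : (fun s => (lin s) ^+ 2) = (fun s => (z 0 i + s * 2) * (z 0 i + s * 2)).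
    by apply/funext => s; rewrite expr2.
  by apply: jet_eq j1 _ _; rewrite mul0r addr0; ring.
move/(jet_powR (a / 2)); rewrite /lin mul0r addr0 => /(_ q0) j2.
have j3 := jet_add j2 (jet_cst (\sum_(j < n | j != i) (z 0 j ^+ 2) `^ (a / 2))).
have E : (fun s => penalty a (z + (s * 2) *: delta_mx 0 i)) =
    (fun s => ((z 0 i + s * 2) ^+ 2) `^ (a / 2)
       + \sum_(j < n | j != i) (z 0 j ^+ 2) `^ (a / 2)).
  apply/funext => s; rewrite /penalty [LHS](bigD1 i) //=.
  rewrite !mxE !eqxx mulr1; congr (_ + _); apply: eq_bigr => j ji.
  by rewrite !mxE (negbTE ji) andbF mulr0 addr0.
eexists; rewrite E; apply: (jet_eq j3); first by [].
rewrite (_ : a / 2 - 1 = (a / 2 - 2) + 1); last by ring.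
rewrite (powRD_gt0 (a / 2 - 2) 1) // powRr1 ?(ltW q0) // addr0.
by field.
Qed.

(** Suppose that [u X - u Y - C * penalty mu (X - Y)] has a positive maximum.  The
    boundary decay forces both points into the interior.  There, compare the
    Laplacians at the two points by second derivative tests: move the points
    together along every coordinate but one, and apart along one coordinate in
    which they differ, say by [t].  The result is that [- laplacian u] at [X] is at
    least a multiple of [C t ^ (mu - 2)].  But [u X] is at least [C t ^ mu], so the
    equation bounds the same quantity by [Lambda (C t ^ mu) ^ (- gamma)].  For
    [mu (1 + gamma) <= 2] these bounds are incompatible when [C] is large. *)
Lemma holder_of_boundary_decay (R : realType) n (gamma Lambda mu C0 : R)
    (Om : set 'rV[R]_n) (f u : 'rV[R]_n -> R) :
  0 < gamma -> open Om -> bounded_set Om ->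
  (forall X, Om X -> 0 <= f X <= Lambda) ->
  solution gamma Om f u ->
  0 < mu < 1 -> mu * (1 + gamma) <= 2 ->
  (forall P X, boundary Om P -> Om X -> u X <= C0 * enorm (X - P) `^ mu) ->
  holder_on mu (closure Om) u.
Proof.
move=> g0 oO bO hf su /andP[m0 m1] mg hC0.
have [c2u cu up eu ub] := su.
have [D D0 hD] := closure_bounded bO.
have u0 X : closure Om X -> 0 <= u X := solution_ge0 oO su.
(* bounds the squared coordinate differences within the domain *)
pose q0 := (2 * D) ^+ 2 + 1.
have q01 : 1 <= q0 by rewrite lerDr sqr_ge0.
pose e := 1 - mu / 2 * (1 + gamma).
have e0 : 0 <= e by rewrite /e; lra.
pose c := 4 * mu * (1 - mu).
have c0 : 0 < c by rewrite /c; apply: mulr_gt0; lra.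
(* the second term handles boundary points, the third interior ones *)
pose C := 1 + `|C0| * n%:R `^ mu + `|Lambda| * q0 `^ e / c.
have t1 : 0 <= `|C0| * n%:R `^ mu by rewrite mulr_ge0 // powR_ge0.
have t2 : 0 <= `|Lambda| * q0 `^ e / c.
  by rewrite divr_ge0 ?(ltW c0) // mulr_ge0 // powR_ge0.
have C1 : 1 <= C by rewrite /C; lra.
pose h (Z : 'rV[R]_n * 'rV[R]_n) := u Z.1 - u Z.2 - C * penalty mu (Z.1 - Z.2).
suff key X Y : closure Om X -> closure Om Y -> h (X, Y) <= 0.
  exists (C * n%:R) => X Y cX cY.
  have le1 A B : closure Om A -> closure Om B ->
      u A - u B <= C * n%:R * enorm (A - B) `^ mu.
    move=> cA cB; have := key A B cA cB; rewrite /h /= subr_le0 => /le_trans.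
    apply; rewrite -mulrA ler_wpM2l ?penalty_le ?(ltW m0) //.
    by apply: le_trans C1.
  by rewrite ler_norml lerNl opprB {1}enormC !le1.
pose K := closure Om `*` closure Om.
have cK : compact K by apply: compact_setX; exact: closure_compact.
have ch : {within K, continuous h}.
  apply/subspace_continuousP => -[A B] [/= cA cB].
  have := cu; move/subspace_continuousP => cu'.
  have cA' : u Z.1 @[Z --> within K (nbhs (A, B))] --> u A.
    apply: cvg_comp (cu' A cA) => S /= nS.
    have : nbhs (A, B) [set Z | closure Om Z.1 -> S Z.1].
      exact: (@cvg_fst _ _ (nbhs A) (nbhs B) _ [set y | closure Om y -> S y] nS).
    by apply: filterS => -[Z1 Z2] /= h1 [/= kz _]; exact: h1.
  have cB' : u Z.2 @[Z --> within K (nbhs (A, B))] --> u B.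
    apply: cvg_comp (cu' B cB) => S /= nS.
    have : nbhs (A, B) [set Z | closure Om Z.2 -> S Z.2].
      exact: (@cvg_snd _ _ (nbhs A) (nbhs B) _ [set y | closure Om y -> S y] nS).
    by apply: filterS => -[Z1 Z2] /= h1 [/= _ kz]; exact: h1.
  apply: cvgB; first exact: cvgB.
  apply: cvgM; first exact: cvg_cst.
  apply: cvg_within_filter.
  apply: (@continuous_comp _ _ _ (fun Z : 'rV[R]_n * 'rV[R]_n => Z.1 - Z.2)
     (@penalty R n mu)); last exact: penalty_continuous.
  by apply: cvgB; [exact: cvg_fst|exact: cvg_snd].
move=> cX cY; rewrite leNgt; apply/negP => hXY.
have [|[A B]] := compact_EVT_max _ cK ch; first by exists (X, Y).
rewrite inE => -[/= cA cB] mAB.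
have hAB : 0 < h (A, B) by apply: lt_le_trans hXY (mAB _ _); rewrite inE.
have mx A' B' : closure Om A' -> closure Om B' -> h (A', B') <= h (A, B).
  by move=> cA' cB'; apply: mAB; rewrite inE.
have pen0 z : 0 <= penalty mu (z : 'rV[R]_n).
  by apply: sumr_ge0 => i _; exact: powR_ge0.
have Cp0 z : 0 <= C * penalty mu (z : 'rV[R]_n).
  by rewrite mulr_ge0 //; apply: le_trans C1.
move: hAB; rewrite /h /= => hAB.
have OA : Om A.
  case: (closure_boundary oO cA) => // /ub uA.
  by have := u0 B cB; have := Cp0 (A - B); lra.
have OB : Om B.
  case: (closure_boundary oO cB) => // bB.
  have := hC0 B A bB OA; have := ub B bB.
  have : C0 * enorm (A - B) `^ mu <= C * penalty mu (A - B).
    apply: (@le_trans _ _ (`|C0| * enorm (A - B) `^ mu)).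
      by rewrite ler_wpM2r ?powR_ge0 // ler_norm.
    apply: (@le_trans _ _ (`|C0| * (n%:R `^ mu * penalty mu (A - B)))).
      by rewrite ler_wpM2l // penalty_ge.
    by rewrite mulrA ler_wpM2r // /C; lra.
  by lra.
have AB : A - B != 0.
  by apply: contraTneq hAB => /eqP; rewrite subr_eq0 => /eqP ->;
     rewrite !subrr sub0r oppr_gt0 -leNgt.
have [i zi _] := argmax_coord AB.
pose q := (A - B) 0 i ^+ 2.
have qp : 0 < q by rewrite exprn_even_gt0.
pose dd j X := partial j (partial j u) X.
have nA v : \forall s \near (0 : R), closure Om (A + s *: v).
  apply: (near_line v (S := closure Om)).
  have : nbhs A Om by exact: open_nbhs_nbhs.
  by apply: filterS; exact: subset_closure.
have nB v : \forall s \near (0 : R), closure Om (B + s *: v).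
  apply: (near_line v (S := closure Om)).
  have : nbhs B Om by exact: open_nbhs_nbhs.
  by apply: filterS; exact: subset_closure.
(* moving both points together leaves the penalty unchanged *)
have par j : j != i -> dd j A - dd j B <= 0.
  move=> _; have jA := C2_on_jet j oO c2u OA; have jB := C2_on_jet j oO c2u OB.
  have jh := jet_add jA (jet_scale (-1) jB).
  rewrite -[dd j B]mul1r -mulNr; apply: jet_max jh _.
  apply: filterS2 (nA (delta_mx 0 j)) (nB (delta_mx 0 j)) => s cAs cBs.
  have := mx _ _ cAs cBs; rewrite !scale0r !addr0 !mulN1r /h /=.
  by rewrite [in X in penalty mu X]opprD addrACA subrr addr0 lerD2r.
(* moving them apart uses the concavity of the penalty *)
have opp : dd i A - dd i B <= C * (4 * mu * (mu - 1) * q `^ (mu / 2 - 1)).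
  have jA := C2_on_jet i oO c2u OA; have jB := jet_opp (C2_on_jet i oO c2u OB).
  have [d jp] := penalty_jet mu zi.
  have jh := jet_add jA (jet_add (jet_scale (-1) jB) (jet_scale (- C) jp)).
  rewrite -subr_le0.
  have -> : dd i A - dd i B - C * (4 * mu * (mu - 1) * q `^ (mu / 2 - 1))
     = dd i A + (-1 * dd i B + - C * (4 * mu * (mu - 1) * q `^ (mu / 2 - 1))).
    by rewrite mulN1r mulNr addrA.
  apply: jet_max jh _.
  apply: filterS2 (nA (delta_mx 0 i)) (nB (- delta_mx 0 i)) => s cAs.
  rewrite scalerN -scaleNr => cBs.
  have E : A + s *: delta_mx 0 i - (B + - s *: delta_mx 0 i)
      = A - B + (s * 2) *: delta_mx 0 i.
    by rewrite scaleNr opprD opprK addrACA -scalerDl mulr_natr.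
  have := mx _ _ cAs cBs.
  by rewrite /h /= E !mul0r oppr0 !scale0r !addr0 !mulN1r !mulNr !addrA.
have lap : laplacian u A - laplacian u B <= C * (4 * mu * (mu - 1) * q `^ (mu / 2 - 1)).
  rewrite /laplacian -sumrB (bigD1 i) //= -[leRHS]addr0 lerD //.
  exact: sumr_le0.
have uA : 0 < u A := up A OA. have uB : 0 < u B := up B OB.
have /andP[fA0 fA] := hf A OA; have /andP[fB0 fB] := hf B OB.
have eA := eu A OA; have eB := eu B OB.
have rB : 0 <= f B * u B `^ (- gamma) by rewrite mulr_ge0 // powR_ge0.
have rA : f A * u A `^ (- gamma) <= `|Lambda| * q `^ (- (mu / 2 * gamma)).
  apply: ler_pM; [exact: fA0|exact: powR_ge0| |].
    exact: le_trans fA (ler_norm _).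
  rewrite -mulrN powRrM; apply: powR_le_baseN; rewrite ?powR_gt0 ?(ltW g0) //.
  apply: le_trans (penalty_ge_coord mu (A - B) i) _.
  have pC : penalty mu (A - B) <= C * penalty mu (A - B) by rewrite ler_peMl.
  apply: le_trans pC _; move: hAB; rewrite subr_gt0 => /ltW/le_trans; apply.
  by rewrite gerBl u0.
have main : c * C * q `^ (mu / 2 - 1) <= `|Lambda| * q `^ (- (mu / 2 * gamma)).
  have -> : c * C * q `^ (mu / 2 - 1) =
     - (C * (4 * mu * (mu - 1) * q `^ (mu / 2 - 1))) by rewrite /c; ring.
  move: rA rB lap; rewrite -eA -eB.
  move: (laplacian u A) (laplacian u B) (C * _) (`|Lambda| * _) => a1 a2 a3 a4.
  by clear; lra.
have {}main : c * C <= `|Lambda| * q0 `^ e.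
  have qq : 0 < q `^ (1 - mu / 2) by rewrite powR_gt0.
  have E1 : q `^ (mu / 2 - 1) * q `^ (1 - mu / 2) = 1.
    by rewrite -powRD_gt0 // (_ : _ + _ = 0) ?powRr0 //; ring.
  have E2 : q `^ (- (mu / 2 * gamma)) * q `^ (1 - mu / 2) = q `^ e.
    by rewrite -powRD_gt0 // /e; congr (_ `^ _); ring.
  have := main; rewrite -(ler_pM2r qq) -(mulrA (c * C)) E1 mulr1.
  rewrite -(mulrA `|Lambda|) E2 => /le_trans; apply; rewrite ler_wpM2l //.
  apply: powR_le_base => //; first exact: ltW.
  apply: (@le_trans _ _ ((2 * D) ^+ 2)); last by rewrite lerDl.
  rewrite /q -real_normK ?num_real // ler_pXn2r ?nnegrE ?mulr_ge0 ?(ltW D0) //.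
  apply: le_trans (le_coord_enorm _ _) _; apply: le_trans (enormD _ _) _.
  by rewrite enormN mulr_natl mulr2n lerD // hD.
move: main; apply/negP; rewrite -ltNge (mulrC c) -ltr_pdivrMr // /C ltrDr.
exact: ltr_pwDl.
Qed.

(** * Comparison with sub- and supersolutions *)

(** Where [u < v] the right-hand side of the equation is larger at [u] than at
    [v], so a strict subsolution cannot touch that region from inside. *)
Lemma comparison_sub (R : realType) n (gamma lambda : R)
    (Om K : set 'rV[R]_n) (f u v : 'rV[R]_n -> R) :
  0 < gamma -> open Om -> 0 < lambda -> (forall X, Om X -> lambda <= f X) ->
  solution gamma Om f u -> compact K -> K `<=` closure Om ->
  {within K, continuous v} ->
  (forall X, K X -> u X < v X -> [/\ nbhs X K, Om X &
     exists g l, has_lap v X g l /\ - l < lambda * v X `^ (- gamma)]) ->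
  forall X, K X -> v X <= u X.
Proof.
move=> g0 oO l0 hf su cK KO cv H X KX; rewrite -subr_le0.
have [c2u cu up eu ub] := su.
apply: (@max_principle R n K (fun Y => v Y - u Y) cK _ _ X KX).
  have cuK := continuous_subspaceW KO cu.
  by move=> Z; apply: (@continuousB _ _ (subspace K)); [exact: cv|exact: cuK].
move=> Y KY; rewrite subr_gt0 => uv.
have [nK OY [g [l [hl ll]]]] := H Y KY uv; split => //.
have hu := has_lap_scale (-1) (C2_on_has_lap oO c2u OY).
do 2 eexists; split.
  by have := has_lap_add hl hu; under [X in has_lap X]eq_fun do rewrite mulN1r;
     exact.
have uY := up Y OY; have eY := eu Y OY.
have : lambda * v Y `^ (- gamma) <= f Y * u Y `^ (- gamma).
  by apply: ler_pM; rewrite ?powR_ge0 ?hf ?(ltW l0) // powR_le_baseN // ltW.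
lra.
Qed.

Lemma comparison_super (R : realType) n (gamma Lambda : R)
    (Om K : set 'rV[R]_n) (f u w : 'rV[R]_n -> R) :
  0 < gamma -> open Om -> (forall X, Om X -> 0 <= f X <= Lambda) ->
  solution gamma Om f u -> compact K -> K `<=` closure Om ->
  {within K, continuous w} ->
  (forall X, K X -> w X < u X -> [/\ nbhs X K, Om X, 0 < w X &
     exists g l, has_lap w X g l /\ Lambda * w X `^ (- gamma) < - l]) ->
  forall X, K X -> u X <= w X.
Proof.
move=> g0 oO hf su cK KO cw H X KX; rewrite -subr_le0.
have [c2u cu up eu ub] := su.
apply: (@max_principle R n K (fun Y => u Y - w Y) cK _ _ X KX).
  have cuK := continuous_subspaceW KO cu.
  by move=> Z; apply: (@continuousB _ _ (subspace K)); [exact: cuK|exact: cw].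
move=> Y KY; rewrite subr_gt0 => uw.
have [nK OY w0 [g [l [hl ll]]]] := H Y KY uw; split => //.
have hu := has_lap_add (C2_on_has_lap oO c2u OY) (has_lap_scale (-1) hl).
do 2 eexists; split.
  by have := hu; under [X in has_lap X]eq_fun do rewrite mulN1r; exact.
have eY := eu Y OY; have /andP[f0 f1] := hf Y OY.
have : f Y * u Y `^ (- gamma) <= Lambda * w Y `^ (- gamma).
  by apply: ler_pM; rewrite ?powR_ge0 // powR_le_baseN // ltW.
lra.
Qed.

Lemma closed_le_continuous (R : realType) (T : topologicalType) (h : T -> R) c :
  continuous h -> closed [set X | h X <= c].
Proof. by move=> ch; apply: (closed_comp _ (@closed_le _ c)) => X _; exact: ch. Qed.

Lemma closed_eball_compact (R : realType) n (P : 'rV[R]_n) r :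
  compact [set Y | enorm (Y - P) <= r].
Proof.
apply: bounded_closed_compact; last 
  exact: (@closed_le_continuous R _ (fun Y : 'rV[R]_n => enorm (Y - P)) r
    (@enorm_continuous R n P)).
exists (r + enorm P); split; first exact: num_real.
move=> x xr Y /= YP; apply: le_trans (normr_le_enorm Y) _.
apply: le_trans (ltW xr); rewrite -[Y in enorm Y](subrK P).
by apply: le_trans (enormD _ _) _; rewrite lerD2r.
Qed.

Lemma near_lt_continuous (R : realType) (T : topologicalType) (h : T -> R) c X :
  {for X, continuous h} -> c < h X -> \forall Y \near X, c < h Y.
Proof. by move=> ch cX; have := ch _ (lt_nbhsr cX). Qed.

Lemma near_gt_continuous (R : realType) (T : topologicalType) (h : T -> R) c X :
  {for X, continuous h} -> h X < c -> \forall Y \near X, h Y < c.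
Proof. by move=> ch cX; have := ch _ (lt_nbhsl cX). Qed.

(** * Lower bounds *)

Lemma scaling_exponent (R : realType) (gamma : R) :
  0 < gamma -> 2 / (1 + gamma) - 2 = 2 / (1 + gamma) * - gamma.
Proof. by move=> g0; field; apply: lt0r_neq0; lra. Qed.

(** A paraboloid vanishing on the sphere is a subsolution once it is scaled by
    the radius to the power [2 / (1 + gamma) - 2]. *)
Lemma ball_lower_bound (R : realType) n (gamma lambda : R) :
  0 < gamma -> 0 < lambda ->
  exists2 c : R, 0 < c & forall (Om : set 'rV[R]_n) (f u : 'rV[R]_n -> R) X d,
    open Om -> (forall X, Om X -> lambda <= f X) -> solution gamma Om f u ->
    0 < d -> eball X d `<=` Om -> c * d `^ (2 / (1 + gamma)) <= u X.
Proof.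
move=> g0 l0; pose b : R := 2 / (1 + gamma).
pose k : R := 2 * n%:R + 1 + lambda.
have n0 : 0 <= n%:R :> R by [].
have k0 : 0 < k by rewrite /k; lra.
pose e := lambda / k.
have e0 : 0 < e by rewrite divr_gt0.
have ke : e * k = lambda by rewrite /e divfK // gt_eqF.
have e1 : e <= 1 by rewrite ler_pdivrMr // mul1r /k; lra.
exists (e * 2^-1 `^ b); first by rewrite mulr_gt0 // powR_gt0 // invr_gt0.
move=> Om f u X d oO hf su d0 BO.
rewrite -mulrA -powRM ?invr_ge0 ?(ltW d0) // (mulrC 2^-1).
(* half the radius keeps the closed ball inside the domain *)
set d2 := d / 2; have d20 : 0 < d2 by rewrite divr_gt0.
pose A := e * d2 `^ (b - 2).
have A0 : 0 < A by rewrite mulr_gt0 // powR_gt0.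
pose v (Y : 'rV[R]_n) := A * (d2 ^+ 2 + -1 * dotv (Y - X) (Y - X)).
have vE Y : v Y = A * (d2 ^+ 2 - enorm (Y - X) ^+ 2).
  by rewrite /v mulN1r enorm_sqr.
have Ad : A * d2 ^+ 2 = e * d2 `^ b.
  rewrite /A -mulrA -powR_mulrn ?(ltW d20) // -powRD_gt0 //.
  by congr (_ * _ `^ _); ring.
have <- : v X = e * d2 `^ b.
  by rewrite vE subrr enorm0 expr0n /= subr0.
pose K := [set Y : 'rV[R]_n | enorm (Y - X) <= d2].
have KO : K `<=` Om.
  move=> Y /= YX; apply: BO; apply: le_lt_trans YX _.
  by rewrite ltr_pdivrMr // mulr_natr mulr2n ltr_pwDl.
apply: (@comparison_sub R n gamma lambda Om K f u v) => //.
- exact: closed_eball_compact.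
- by move=> Y /KO; exact: subset_closure.
- apply: within_continuous_of => Y _.
  have -> : v = (fun Y => A * (d2 ^+ 2 - enorm (Y - X) ^+ 2)).
    by apply/funext => Z; exact: vE.
  apply: (@continuousM _ _ (cst A)); first exact: cst_continuous.
  apply: (@continuousB _ _ _ (cst _)); first exact: cst_continuous.
  apply: (@continuous_comp _ _ _ (fun y : 'rV[R]_n => enorm (y - X)) (fun t : R => t ^+ 2)).
    exact: enorm_continuous.
  exact: exprn_continuous.
- move=> Y KY uv; have OY := KO Y KY.
  have [_ _ /(_ Y OY) uY _ _] := su.
  have v0 : 0 < v Y by apply: lt_trans uv.
  have Yd : enorm (Y - X) < d2.
    move: v0; rewrite vE pmulr_rgt0 // subr_gt0.
    by rewrite ltr_pXn2r ?nnegrE ?enorm_ge0 ?ltW.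
  split => //.
    have : \forall Z \near Y, enorm (Z - X) < d2.
      exact: near_in_eball Yd.
    by apply: filterS => Z; exact: ltW.
  do 2 eexists; split.
    exact: has_lap_scale (has_lap_add (has_lap_cst _ _)
             (has_lap_scale (-1) (has_lap_sq X Y))).
  have : d2 `^ (b - 2) <= v Y `^ (- gamma).
    have vle : v Y <= d2 `^ b.
      apply: (@le_trans _ _ (e * d2 `^ b)); last by rewrite ler_piMl // powR_ge0.
      by rewrite vE -Ad ler_wpM2l ?(ltW A0) // gerBl sqr_ge0.
    have := powR_le_baseN (ltW g0) v0 vle.
    by rewrite -powRrM scaling_exponent.
  rewrite -(ler_pM2l l0); apply: lt_le_trans.
  rewrite (_ : - _ = A * (2 * n%:R)); last by ring.
  rewrite (_ : lambda * _ = A * k); last by rewrite -ke /A; ring.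
  by rewrite ltr_pM2l // /k; lra.
- by rewrite /K /= subrr enorm0 ltW.
Qed.

Lemma has_lap_enorm (R : realType) n (P X : 'rV[R]_n) :
  X != P ->
  has_lap (fun Y => enorm (Y - P)) X ((enorm (X - P))^-1 *: (X - P))
    ((n%:R - 1) / enorm (X - P)).
Proof.
move=> XP; set r := enorm (X - P).
have r0 : 0 < r by rewrite enorm_gt0 // subr_eq0.
have qE : dotv (X - P) (X - P) = r ^+ 2 by rewrite enorm_sqr.
have q0 : 0 < dotv (X - P) (X - P) by rewrite qE exprn_gt0.
have := @has_lap_powR R n 2^-1 (fun Y => dotv (Y - P) (Y - P)) X _ _ q0 (has_lap_sq P X).
have -> : (fun Y : 'rV[R]_n => dotv (Y - P) (Y - P) `^ 2^-1)
    = (fun Y => enorm (Y - P)).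
  by apply/funext => Y; rewrite powR12_sqrt // dotv_ge0.
have pE x : dotv (X - P) (X - P) `^ x = r `^ (2 * x).
  by rewrite qE -powR_mulrn ?(ltW r0) // -powRrM.
rewrite !pE.
have -> : r `^ (2 * (2^-1 - 1)) = r^-1.
  by rewrite -[RHS](powR_inv1 (ltW r0)); congr (_ `^ _); field.
rewrite /=; have -> : r `^ (2 * (2^-1 - 2)) = r ^- 3.
  by rewrite -(powR_mulrn 3 (ltW r0)) -powRN; congr (_ `^ _); field.
move/has_lap_eq; apply.
  by rewrite scalerA; congr (_ *: _); field; exact: lt0r_neq0.
rewrite dotvZl dotvZr qE; field; exact: lt0r_neq0.
Qed.

(** Positive on a round cone with axis [v] and apex [P], which is narrower than
    a half-space for [k < 0] and wider for [k > 0]. *)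
Definition cone_fun (R : realType) n (v P : 'rV[R]_n) (k : R) (Y : 'rV[R]_n) : R :=
  dotv v (Y - P) + k * enorm (Y - P).

Lemma cone_fun_continuous (R : realType) n (v P : 'rV[R]_n) (k : R) :
  continuous (cone_fun v P k).
Proof.
move=> X; apply: (@continuousD _ _ _ (fun Y : 'rV[R]_n => dotv v (Y - P))).
  exact: dotv_continuous.
apply: (@continuousM _ _ (cst k)); first exact: cst_continuous.
exact: enorm_continuous.
Qed.

Lemma has_lap_cone (R : realType) n (v P X : 'rV[R]_n) (k : R) :
  X != P -> has_lap (cone_fun v P k) X
    (v + k *: ((enorm (X - P))^-1 *: (X - P)))
    (k * ((n%:R - 1) / enorm (X - P))).
Proof.
move=> XP; rewrite -[X in has_lap _ _ _ X]add0r.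
exact: has_lap_add (has_lap_lin v P X) (has_lap_scale k (has_lap_enorm XP)).
Qed.

Lemma cone_grad (R : realType) n (v P X : 'rV[R]_n) (k : R) :
  X != P -> enorm v = 1 ->
  dotv (v + k *: ((enorm (X - P))^-1 *: (X - P)))
       (v + k *: ((enorm (X - P))^-1 *: (X - P)))
  = 1 + 2 * k * (dotv v (X - P) / enorm (X - P)) + k ^+ 2.
Proof.
move=> XP v1; have r0 : 0 < enorm (X - P) by rewrite enorm_gt0 // subr_eq0.
move: (X - P) r0 => Z r0.
rewrite !dotvE (dotvC Z v) -!enorm_sqr v1.
by field; exact: lt0r_neq0.
Qed.

Lemma has_lap_cone_powR (R : realType) n (v P X : 'rV[R]_n) (k p : R) :
  X != P -> enorm v = 1 -> 0 < cone_fun v P k X ->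
  exists g, has_lap (fun Y => cone_fun v P k Y `^ p) X g
    (p * cone_fun v P k X `^ (p - 2) *
      ((p - 1) * (1 + 2 * k * (dotv v (X - P) / enorm (X - P)) + k ^+ 2)
       + k * (n%:R - 1) * (cone_fun v P k X / enorm (X - P)))).
Proof.
move=> XP v1 a0; eexists.
apply: has_lap_eq (has_lap_powR p a0 (has_lap_cone v k XP)) erefl _.
rewrite cone_grad // (_ : p - 1 = p - 2 + 1); last by ring.
rewrite (powRD_gt0 (p - 2) 1) // powRr1 ?(ltW a0) //.
ring.
Qed.

Lemma dotv_le_enorm (R : realType) n (v X : 'rV[R]_n) :
  enorm v = 1 -> dotv v X <= enorm X.
Proof. by move=> v1; apply: le_trans (cauchy_schwarz _ _) _; rewrite v1 mul1r. Qed.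

Lemma dotv_shift_ge (R : realType) n (v P Y Z : 'rV[R]_n) :
  enorm v = 1 -> dotv v (Y - P) - enorm (Z - Y) <= dotv v (Z - P).
Proof.
move=> v1; have := dotv_le_enorm (Y - Z) v1; rewrite (enormC Z Y).
have -> : dotv v (Z - P) = dotv v (Y - P) - dotv v (Y - Z).
  by rewrite !dotvE; ring.
by rewrite lerD2l lerN2.
Qed.

(** In a cone slightly narrower than a half-space there is a homogeneous
    subharmonic function, positive inside and zero on the lateral boundary, of
    any given degree [alpha > 1]; a small multiple of it lies below [u]. *)
Lemma cone_lower_bound (R : realType) n (gamma lambda alpha : R)
    (Om : set 'rV[R]_n) (f u : 'rV[R]_n -> R) :
  0 < gamma -> 0 < lambda -> 1 < alpha -> open Om ->
  (forall X, Om X -> lambda <= f X) -> solution gamma Om f u ->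
  exists2 s : R, 0 < s < 4^-1 & forall rho : R, 0 < rho ->
  exists2 c : R, 0 < c & forall P v, closure Om P -> enorm v = 1 ->
    (forall Y, eball P rho Y -> s * enorm (Y - P) < dotv v (Y - P) -> Om Y) ->
    forall d, 0 < d <= rho / 2 -> c * d `^ alpha <= u (P + d *: v).
Proof.
move=> g0 l0 a1 oO hf su.
have n0 : 0 <= n%:R :> R by [].
(* k solves (alpha - 1) * (1 - 2 * k) = k * n, which yields subharmonicity *)
pose den : R := 2 * (alpha - 1) + n%:R.
have den0 : 0 < den by rewrite /den; lra.
pose k : R := (alpha - 1) / den.
have k0 : 0 < k by rewrite divr_gt0 // subr_gt0.
have kden : k * den = alpha - 1 by rewrite /k divfK // lt0r_neq0.
have k2 : k <= 2^-1.
  by rewrite ler_pdivrMr // /den; lra.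
exists (k / 3); first by apply/andP; split; lra.
set s := k / 3 => rho rho0; pose r1 := rho / 2.
have r10 : 0 < r1 by rewrite divr_gt0.
have [cb cb0 hcb] := ball_lower_bound n g0 l0.
pose sg := s * r1 / 2.
have s0 : 0 < s by rewrite /s; lra.
have s1 : s <= 1 by rewrite /s; lra.
have sg0 : 0 < sg by rewrite /sg divr_gt0 // mulr_gt0.
have sr : s * r1 <= r1 by rewrite ler_piMl // ltW.
pose c0 := cb * sg `^ (2 / (1 + gamma)).
have c00 : 0 < c0 by rewrite mulr_gt0 // powR_gt0.
pose eta := c0 / r1 `^ alpha.
have eta0 : 0 < eta by rewrite divr_gt0 // powR_gt0.
exists (eta * (1 - k) `^ alpha).
  by rewrite mulr_gt0 // powR_gt0; lra.
move=> P v cP v1 hP d /andP[d0 d1].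
pose a := cone_fun v P (- k).
pose w Y := eta * Num.max (a Y) 0 `^ alpha.
pose K := [set Y | enorm (Y - P) <= r1] `&` [set Y | - a Y <= 0].
have tr Y : dotv v (Y - P) <= enorm (Y - P) by exact: dotv_le_enorm.
have KO Y : K Y -> Y = P \/ Om Y.
  move=> [/= YP aY]; have [->|YnP] := eqVneq Y P; [by left|right].
  have rY : 0 < enorm (Y - P) by rewrite enorm_gt0 // subr_eq0.
  apply: hP; first by rewrite /eball /=; apply: le_lt_trans YP _; rewrite /r1; lra.
  move: aY; rewrite /a /cone_fun oppr_le0 mulNr subr_ge0; apply: lt_le_trans.
  by rewrite ltr_pM2r // /s; lra.
have ddP : enorm (P + d *: v - P) = d.
  by rewrite (addrC P) addrK enormZ v1 mulr1 gtr0_norm.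
have aX : a (P + d *: v) = (1 - k) * d.
  rewrite /a /cone_fun ddP (addrC P) addrK dotvZr -enorm_sqr v1; ring.
have <- : w (P + d *: v) = eta * (1 - k) `^ alpha * d `^ alpha.
  have k10 : 0 <= 1 - k by lra.
  have aX0 : 0 <= (1 - k) * d by rewrite mulr_ge0 // ltW.
  by rewrite /w aX max_l // powRM ?(ltW d0) // mulrA.
have ca : continuous a by exact: cone_fun_continuous.
apply: (@comparison_sub R n gamma lambda Om K f u w) => //.
- apply: (@subclosed_compact _ _ [set Y | enorm (Y - P) <= r1]).
  + apply: closedI; first exact: (@closed_le_continuous R _
       (fun Y : 'rV[R]_n => enorm (Y - P)) r1 (@enorm_continuous R n P)).
    apply: (@closed_le_continuous R _ (fun Y : 'rV[R]_n => - a Y)) => Y.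
    by apply: continuousN; exact: ca.
  + exact: closed_eball_compact.
  + by move=> Y [].
- by move=> Y /KO[->//|]; exact: subset_closure.
- apply: within_continuous_of => Y _.
  apply: (@continuousM _ _ (cst eta)); first exact: cst_continuous.
  apply: (@continuous_comp _ _ _ a (fun t : R => Num.max t 0 `^ alpha)).
    exact: ca.
  by apply: powR_max_continuous; lra.
- move=> Y KY uw; have [YP aY] := KY.
  have u0 : 0 <= u Y.
    by apply: solution_ge0 su _ => //; case: (KO Y KY) => [->//|]; exact: subset_closure.
  have w0 : 0 < w Y by exact: le_lt_trans uw.
  have a0 : 0 < a Y.
    rewrite ltNge; apply/negP => a0; move: w0.
    by rewrite /w max_r // powR0 ?mulr0 ?ltxx // lt0r_neq0 //; lra.
  have YnP : Y != P.
    apply: contraTneq a0 => ->.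
    by rewrite /a /cone_fun subrr dotv0r enorm0 mulr0 addr0 ltxx.
  have OY : Om Y by case: (KO Y KY) => // YE; rewrite YE eqxx in YnP.
  have rY : 0 < enorm (Y - P) by rewrite enorm_gt0 // subr_eq0.
  (* on the sphere the ball estimate beats the barrier *)
  have Yr : enorm (Y - P) < r1.
    rewrite lt_neqAle YP andbT; apply/eqP => Yr.
    move: uw; apply/negP; rewrite -leNgt.
    apply: (@le_trans _ _ c0).
      rewrite /w max_l ?(ltW a0) // /eta -mulrA ler_piMr ?(ltW c00) //.
      rewrite mulrC ler_pdivrMr ?powR_gt0 // mul1r powR_le_base ?(ltW a0) //.
        by lra.
      rewrite -Yr /a /cone_fun; apply: le_trans (tr Y).
      by rewrite mulNr gerBl mulr_ge0 // ltW.
    apply: (hcb _ _ _ _ _ oO hf su sg0) => Z; rewrite /eball /= => ZY.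
    have ZP := enorm_dist Z Y P; rewrite Yr in ZP.
    have tZ := dotv_shift_ge P Y Z v1.
    have tY : k * r1 < dotv v (Y - P).
      by move: a0; rewrite /a /cone_fun mulNr subr_gt0 Yr.
    have sgE : 2 * sg = s * r1 by rewrite /sg; field.
    have kE : k * r1 = 3 * (s * r1) by rewrite /s; field.
    apply: hP; rewrite /eball /=.
      by move: ZP ZY sgE sr r10; rewrite /r1; clear; lra.
    have sZ : s * enorm (Z - P) <= s * r1 + sg.
      apply: (@le_trans _ _ (s * (r1 + sg))).
        by rewrite ler_pM2l //; move: ZP ZY; clear; lra.
      by rewrite mulrDr lerD2l ler_piMl // ltW.
    by move: sZ tZ tY sgE kE ZY sg0; clear; lra.
  split => //.
    have n1 := near_in_eball Yr.
    have n2 : \forall Z \near Y, 0 < a Z.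
      exact: (@near_lt_continuous R _ a 0 Y (ca Y) a0).
    by apply: filterS2 n1 n2 => Z /= z1 z2; split; rewrite /= ?oppr_le0 ltW.
  have [g hg] := has_lap_cone_powR alpha YnP v1 a0.
  do 2 eexists; split.
    apply: has_lap_near (has_lap_scale eta hg).
    have n2 : \forall Z \near Y, 0 < a Z.
      exact: (@near_lt_continuous R _ a 0 Y (ca Y) a0).
    by apply: filterS n2 => Z z2; rewrite /w max_l // ltW.
  apply: (@le_lt_trans _ _ 0); last by rewrite mulr_gt0 // powR_gt0.
  rewrite oppr_le0 mulr_ge0 ?(ltW eta0) // mulr_ge0 ?mulr_ge0 ?powR_ge0 //.
    by lra.
  set T := dotv v (Y - P) / enorm (Y - P).
  have T1 : T <= 1 by rewrite ler_pdivrMr // mul1r.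
  have -> : cone_fun v P (- k) Y / enorm (Y - P) = T - k.
    by rewrite /cone_fun /T; field; exact: lt0r_neq0.
  have Tk : 0 <= T - k.
    rewrite subr_ge0 ler_pdivlMr //.
    by move: a0; rewrite /a /cone_fun mulNr subr_gt0 => /ltW.
  have e1 : (alpha - 1) * (1 - 2 * k) = k * n%:R.
    by rewrite mulrBr mulr1 -{1}kden /den; ring.
  have e2 : (alpha - 1) * (1 - 2 * k) <= (alpha - 1) * (1 + 2 * - k * T + (- k) ^+ 2).
    rewrite ler_wpM2l; [by []|by lra|].
    have : 0 <= (- k) ^+ 2 by exact: sqr_ge0.
    have : k * T <= k by rewrite ler_piMr // ltW.
    by clear; lra.
  have e3 : k * (n%:R - 1) * (T - k) <= k * n%:R.
    rewrite -mulrA ler_pM2l //.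
    apply: (@le_trans _ _ (n%:R * (T - k))).
      by rewrite ler_wpM2r // gerBl.
    by rewrite ler_piMr //; move: T1 k0; clear; lra.
  by move: e1 e2 e3; clear; lra.
- split; rewrite /= ?ddP // aX oppr_le0.
  by rewrite mulr_ge0 ?(ltW d0) //; lra.
Qed.

(** In a half-space the degree one is reached too: [t] itself is harmonic, but
    on the sphere it exceeds [u] near the bounding hyperplane.  Adding a harmonic
    quadratic term makes the barrier negative there. *)
Lemma halfspace_lower_bound (R : realType) n (gamma lambda : R)
    (Om : set 'rV[R]_n) (f u : 'rV[R]_n -> R) :
  (0 < n)%N -> 0 < gamma -> 0 < lambda -> open Om ->
  (forall X, Om X -> lambda <= f X) -> solution gamma Om f u ->
  forall rho : R, 0 < rho ->
  exists2 c : R, 0 < c & forall P v, enorm v = 1 ->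
    (forall Y, eball P rho Y -> 0 < dotv v (Y - P) -> Om Y) ->
    forall d, 0 < d <= rho / 2 -> c * d <= u (P + d *: v).
Proof.
move=> n0 g0 l0 oO hf su rho rho0; pose r1 := rho / 2.
have r10 : 0 < r1 by rewrite divr_gt0.
have rr : rho = 2 * r1 by rewrite /r1; field.
have n1 : 1 <= n%:R :> R by rewrite ler1n.
have [cb cb0 hcb] := ball_lower_bound n g0 l0.
pose sg := r1 / (1 + n%:R).
have nn0 : 0 < 1 + n%:R :> R by lra.
have sg0 : 0 < sg by rewrite divr_gt0.
have sgn : sg * (1 + n%:R) = r1 by rewrite /sg divfK // lt0r_neq0.
have sgr : sg <= r1 by rewrite ler_pdivrMr // ler_peMr ?(ltW r10) //; lra.
pose c0 := cb * sg `^ (2 / (1 + gamma)).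
have c00 : 0 < c0 by rewrite mulr_gt0 // powR_gt0.
have rn0 : 0 < r1 * (1 + n%:R) by rewrite mulr_gt0.
pose eta := c0 / (r1 * (1 + n%:R)).
have eta0 : 0 < eta by rewrite divr_gt0.
exists eta => // P v v1 hP d /andP[d0 d1].
pose t Y := dotv v (Y - P).
pose b := r1^-1.
have b0 : 0 < b by rewrite invr_gt0.
have br : b * r1 = 1 by rewrite /b mulVf // lt0r_neq0.
pose w Y := eta * (t Y + (n%:R * b * (t Y * t Y) + (- b) * dotv (Y - P) (Y - P))).
pose K := [set Y | enorm (Y - P) <= r1] `&` [set Y | - t Y <= 0].
have tr Y : t Y <= enorm (Y - P) by exact: dotv_le_enorm.
have ct : continuous t by exact: dotv_continuous.
have KO Y : K Y -> closure Om Y.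
  move=> [/= YP tY] S /near_eball[e e0 he].
  pose q := Num.min (e / 2) r1.
  have q0 : 0 < q by rewrite lt_min divr_gt0.
  have q1 : q <= e / 2 by rewrite ge_min lexx.
  have q2 : q <= r1 by rewrite ge_min lexx orbT.
  have Zq : enorm (q *: v) = q by rewrite enormZ v1 mulr1 gtr0_norm.
  have tq : dotv v (Y + (q / 2) *: v - P) = t Y + q / 2.
    by rewrite addrAC dotvDr dotvZr -[dotv v v]enorm_sqr v1 expr1n mulr1.
  have Zq2 : enorm ((q / 2) *: v) = q / 2.
    by rewrite enormZ v1 mulr1 gtr0_norm // divr_gt0.
  exists (Y + (q / 2) *: v); split.
    apply: hP; last by rewrite tq; move: tY q0; clear; lra.
    rewrite /eball /= addrAC; apply: le_lt_trans (enormD _ _) _.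
    by rewrite Zq2 rr; move: YP q0 q2 r10; clear; lra.
  apply: he; rewrite /eball /= (addrC Y) addrK Zq2.
  by move: q1 q0 e0; clear; lra.
have ddP : P + d *: v - P = d *: v by rewrite (addrC P) addrK.
have tX : t (P + d *: v) = d.
  by rewrite /t ddP dotvZr -enorm_sqr v1 expr1n mulr1.
apply: (@le_trans _ _ (w (P + d *: v))).
  rewrite /w tX ddP dotvZl dotvZr -enorm_sqr v1 expr1n mulr1 ler_pM2l //.
  rewrite lerDl (_ : _ + _ = (n%:R - 1) * (b * (d * d))); last by ring.
  by rewrite !mulr_ge0 ?(ltW d0) ?(ltW b0) // subr_ge0.
have cw Y : {for Y, continuous w}.
  apply: (@continuousM _ _ (cst eta)); first exact: cst_continuous.
  apply: (@continuousD _ _ _ t); first exact: ct.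
  apply: (@continuousD _ _ _ (fun Z => n%:R * b * (t Z * t Z))).
    apply: (@continuousM _ _ (cst _)); first exact: cst_continuous.
    by apply: (@continuousM _ _ t t); exact: ct.
  apply: (@continuousM _ _ (cst _)); first exact: cst_continuous.
  have -> : (fun Z : 'rV[R]_n => dotv (Z - P) (Z - P)) =
      (fun Z => enorm (Z - P) ^+ 2) by apply/funext => Z; rewrite enorm_sqr.
  apply: (@continuous_comp _ _ _ (fun Z : 'rV[R]_n => enorm (Z - P)) (fun s : R => s ^+ 2)).
    exact: enorm_continuous.
  exact: exprn_continuous.
apply: (@comparison_sub R n gamma lambda Om K f u w) => //.
- apply: (@subclosed_compact _ _ [set Y | enorm (Y - P) <= r1]).
  + apply: closedI; first exact: (@closed_le_continuous R _
       (fun Y : 'rV[R]_n => enorm (Y - P)) r1 (@enorm_continuous R n P)).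
    apply: (@closed_le_continuous R _ (fun Y : 'rV[R]_n => - t Y)) => Y.
    by apply: continuousN; exact: ct.
  + exact: closed_eball_compact.
  + by move=> Y [].
- by apply: within_continuous_of => Y _; exact: cw.
- move=> Y KY uw; have [YP tY] := KY.
  have u0 : 0 <= u Y by apply: solution_ge0 su _ => //; exact: KO.
  have w0 : 0 < w Y by exact: le_lt_trans uw.
  have wE : w Y = eta * (t Y + n%:R * b * (t Y * t Y) - b * enorm (Y - P) ^+ 2).
    by rewrite /w enorm_sqr; ring.
  have t0 : 0 < t Y.
    rewrite lt_neqAle eq_sym; move: tY; rewrite /= oppr_le0 => ->; rewrite andbT.
    apply: contraTneq w0 => t00; rewrite -leNgt wE t00 mulr0 mulr0 !add0r.
    rewrite mulrN oppr_le0 mulr_ge0 ?(ltW eta0) // mulr_ge0 ?(ltW b0) //.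
    exact: sqr_ge0.
  have Yr : enorm (Y - P) < r1.
    rewrite lt_neqAle YP andbT; apply/eqP => Yr.
    have ty1 : t Y <= r1 by rewrite -Yr.
    have btt : b * (t Y * t Y) <= t Y.
      rewrite mulrA ler_piMl ?(ltW t0) //.
      by rewrite -br ler_pM2l.
    have brr : b * enorm (Y - P) ^+ 2 = r1 by rewrite Yr expr2 mulrA br mul1r.
    have nbt : n%:R * b * (t Y * t Y) <= n%:R * t Y.
      by rewrite -mulrA ler_wpM2l.
    have sgt : sg < t Y.
      rewrite -(ltr_pM2r nn0) sgn.
      move: w0; rewrite wE pmulr_rgt0 // brr subr_gt0 => /lt_le_trans; apply.
      by rewrite mulrDr mulr1 lerD2l (mulrC (t Y) n%:R).
    move: uw; apply/negP; rewrite -leNgt.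
    apply: (@le_trans _ _ c0).
      rewrite wE brr /eta mulrAC ler_pdivrMr // ler_pM2l //.
      have : n%:R * t Y <= n%:R * r1 by rewrite ler_wpM2l.
      by rewrite mulrDr mulr1 (mulrC r1); move: nbt ty1 r10; clear; lra.
    apply: (hcb _ _ _ _ _ oO hf su sg0) => Z; rewrite /eball /= => ZY.
    have ZP := enorm_dist Z Y P; rewrite Yr in ZP.
    have tZ := dotv_shift_ge P Y Z v1.
    apply: hP; rewrite /eball /=.
      by rewrite rr; move: ZP ZY sgr; clear; lra.
    by rewrite -/(t Y) in tZ; move: tZ sgt ZY; clear; lra.
  split => //.
  + have m1 := near_in_eball Yr.
    have m2 : \forall Z \near Y, 0 < t Z.
      exact: (@near_lt_continuous R _ t 0 Y (ct Y) t0).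
    by apply: filterS2 m1 m2 => Z /= z1 z2; split; rewrite /= ?oppr_le0 ltW.
  + apply: hP => //; rewrite /eball /= rr.
    by move: Yr r10; clear; lra.
  have lt := has_lap_lin v P Y.
  do 2 eexists; split.
    exact: has_lap_scale (has_lap_add lt (has_lap_add
      (has_lap_scale (n%:R * b) (has_lap_mul lt lt))
      (has_lap_scale (- b) (has_lap_sq P Y)))).
  rewrite -enorm_sqr v1 expr1n (_ : - _ = 0); last by ring.
  by rewrite mulr_gt0 // powR_gt0.
- split; rewrite /= ?ddP ?tX ?oppr_le0 ?(ltW d0) //.
  by rewrite enormZ v1 mulr1 gtr0_norm.
Qed.

(** * Upper bounds *)

(** Supersolutions for [- Laplacian], comparable to the [beta]-th power of the
    distance to the apex, in the cone of all directions at cosine at least [- s]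
    from the axis.  The constants must not depend on the axis or the apex, which
    will range over all normals and boundary points. *)
Definition cone_barrier (R : realType) (n : nat) (beta s : R) : Prop :=
  exists c1 c2 c3 : R, [/\ 0 < c1, 0 < c2, 0 < c3 &
    forall v P : 'rV[R]_n, enorm v = 1 ->
    exists b : 'rV[R]_n -> R, forall Y, Y != P ->
      - s * enorm (Y - P) <= dotv v (Y - P) ->
      [/\ {for Y, continuous b},
          c1 * enorm (Y - P) `^ beta <= b Y <= c2 * enorm (Y - P) `^ beta &
          exists g l, has_lap b Y g l /\ l <= - c3 * enorm (Y - P) `^ (beta - 2)]].

(** For cones close to a half-space, the concavity of [t ^ beta] dominates the
    effect of a small perturbation of [t] that makes it positive on the cone. *)
Lemma cone_barrier_flat (R : realType) n (beta : R) :
  0 < beta < 1 -> exists2 s : R, 0 < s & cone_barrier n beta s.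
Proof.
move=> /andP[b0 b1].
have n0 : 0 <= n%:R :> R by [].
(* small enough for the curvature term, at most 2 * k * n, to be dominated *)
pose den : R := 4 * (n%:R + 1).
have den0 : 0 < den by rewrite /den; lra.
pose k : R := (1 - beta) / den.
have k0 : 0 < k by rewrite divr_gt0 // subr_gt0.
have kden : k * den = 1 - beta by rewrite /k divfK // lt0r_neq0.
have k1 : k <= 1 by rewrite ler_pdivrMr // /den; lra.
exists (k / 2); first by rewrite divr_gt0.
have k20 : 0 < k / 2 by rewrite divr_gt0.
have c30 : 0 < beta * ((1 - beta) / 2) * 2 `^ (beta - 2).
  by rewrite mulr_gt0 ?powR_gt0 // mulr_gt0 // divr_gt0 // subr_gt0.
exists ((k / 2) `^ beta), (2 `^ beta), (beta * ((1 - beta) / 2) * 2 `^ (beta - 2)).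
split; rewrite ?powR_gt0 // => v P v1.
exists (fun Y => cone_fun v P k Y `^ beta) => Y YnP tY.
have r0 : 0 < enorm (Y - P) by rewrite enorm_gt0 // subr_eq0.
have tr : dotv v (Y - P) <= enorm (Y - P) by exact: dotv_le_enorm.
have alo : k / 2 * enorm (Y - P) <= cone_fun v P k Y.
  by move: tY; rewrite /cone_fun; move: (dotv _ _) (enorm _) => x y; clear; lra.
have a0 : 0 < cone_fun v P k Y by apply: lt_le_trans alo; rewrite mulr_gt0.
have ahi : cone_fun v P k Y <= 2 * enorm (Y - P).
  have : k * enorm (Y - P) <= enorm (Y - P) by rewrite ler_piMl // ltW.
  by move: tr; rewrite /cone_fun; move: (dotv _ _) (enorm _) => x y; clear; lra.
split.
- apply: (@continuous_comp _ _ _ (cone_fun v P k) (fun x : R => x `^ beta)).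
    exact: cone_fun_continuous.
  exact: powR_continuous.
- rewrite -!powRM ?(ltW r0) ?(ltW k20) //; apply/andP; split.
    by apply: powR_le_base alo; [exact: ltW|exact/ltW/mulr_gt0].
  by apply: powR_le_base ahi; exact: ltW.
have [g hg] := has_lap_cone_powR beta YnP v1 a0.
do 2 eexists; split; first exact: hg.
set T := dotv v (Y - P) / enorm (Y - P).
have T1 : T <= 1 by rewrite ler_pdivrMr // mul1r.
have Tk : - (k / 2) <= T by rewrite ler_pdivlMr // mulNr -mulNr.
have -> : cone_fun v P k Y / enorm (Y - P) = T + k.
  by rewrite /cone_fun /T; field; exact: lt0r_neq0.
set D := cone_fun v P k Y `^ (beta - 2).
have D0 : 0 < D by rewrite powR_gt0.
have DD : 2 `^ (beta - 2) * enorm (Y - P) `^ (beta - 2) <= D.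
  rewrite -powRM ?(ltW r0) // /D -(opprB 2 beta).
  by apply: powR_le_baseN => //; rewrite subr_ge0; apply: (@le_trans _ _ 1); lra.
have e1 : (beta - 1) * (1 + 2 * k * T + k ^+ 2) <= beta - 1.
  have : 0 <= 2 * k * T + k ^+ 2.
    have -> : 2 * k * T + k ^+ 2 = 2 * k * (T + k / 2) by field.
    apply: mulr_ge0; first by rewrite mulr_ge0 // ltW.
    by rewrite -lerBlDr sub0r.
  rewrite -addrA; move: (2 * k * T + k ^+ 2) => z z0.
  rewrite -[leRHS]mulr1; apply: ler_wnM2l; first by rewrite subr_le0 ltW.
  by rewrite lerDl.
have e2 : k * (n%:R - 1) * (T + k) <= (1 - beta) / 2.
  have kn : k * n%:R <= (1 - beta) / 4.
    by rewrite -kden /den; move: k0; clear; lra.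
  have Tk0 : 0 <= T + k by move: Tk k0; clear; lra.
  apply: (@le_trans _ _ (k * n%:R * (T + k))).
    by rewrite ler_wpM2r // ler_pM2l // gerBl.
  apply: (@le_trans _ _ (k * n%:R * 2)).
    apply: ler_wpM2l; first by rewrite mulr_ge0 // ltW.
    by rewrite (_ : 2 = 1 + 1) ?lerD.
  by move: kn; clear; lra.
apply: (@le_trans _ _ (beta * D * - ((1 - beta) / 2))).
  rewrite ler_pM2l ?mulr_gt0 //.
  by move: e1 e2; clear; lra.
rewrite (_ : _ * - _ = - (beta * ((1 - beta) / 2) * D)); last by ring.
rewrite [leRHS](_ : _ = - (beta * ((1 - beta) / 2)
   * (2 `^ (beta - 2) * enorm (Y - P) `^ (beta - 2)))); last by ring.
by rewrite lerN2 ler_pM2l // mulr_gt0 // divr_gt0 // subr_gt0.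
Qed.

Lemma has_lap_enorm_powR (R : realType) n (P X : 'rV[R]_n) (q : R) :
  X != P ->
  has_lap (fun Y => enorm (Y - P) `^ q) X
    ((q * enorm (X - P) `^ (q - 1)) *: ((enorm (X - P))^-1 *: (X - P)))
    (q * (q + n%:R - 2) * enorm (X - P) `^ (q - 2)).
Proof.
move=> XP; have r0 : 0 < enorm (X - P) by rewrite enorm_gt0 // subr_eq0.
apply: has_lap_eq (@has_lap_powR R n q (fun Y => enorm (Y - P)) X _ _ r0
  (has_lap_enorm XP)) erefl _.
rewrite /= dotvZl dotvZr -enorm_sqr (_ : q - 1 = q - 2 + 1); last by ring.
rewrite (powRD_gt0 (q - 2) 1) // powRr1 ?(ltW r0) //.
by field; exact: lt0r_neq0.
Qed.

Lemma cone_grad_radial (R : realType) n (v P X : 'rV[R]_n) (k : R) :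
  X != P ->
  dotv ((enorm (X - P))^-1 *: (X - P))
       (v + k *: ((enorm (X - P))^-1 *: (X - P)))
  = dotv v (X - P) / enorm (X - P) + k.
Proof.
move=> XP; have r0 : 0 < enorm (X - P) by rewrite enorm_gt0 // subr_eq0.
move: (X - P) r0 => Z r0; rewrite !dotvE (dotvC Z v) -!enorm_sqr.
by field; exact: lt0r_neq0.
Qed.

(** For an arbitrary cone the power has to be small.  In dimension one the power
    of the distance to the apex is itself concave.  In higher dimension the
    zero-homogeneous function [(r / (r + t)) ^ n] is subharmonic, uniformly so on
    the cone, and subtracting it from a large constant before multiplying by the
    power of [r] outweighs the subharmonicity of that power. *)
Lemma cone_barrier_lipschitz (R : realType) n (s m0 : R) :
  (0 < n)%N -> 0 < s < 1 -> 0 < m0 ->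
  exists mu : R, [/\ 0 < mu < 1, mu <= m0 & cone_barrier n mu s].
Proof.
move=> n0 /andP[s0 s1] m00.
have : n = 1%N \/ (2 <= n)%N by case: n n0 => [|[|n]] // _; [left|right].
case=> [n1|n2].
  pose mu := Num.min m0 2^-1.
  have mu0 : 0 < mu by rewrite lt_min m00 /= invr_gt0 ltr0n.
  have mu1 : mu < 1.
    by apply: (@le_lt_trans _ _ 2^-1); [rewrite ge_min lexx orbT|lra].
  exists mu; split; [by rewrite mu0|by rewrite ge_min lexx|].
  exists 1, 1, (mu * (1 - mu)); split=> //.
    by rewrite mulr_gt0 // subr_gt0.
  move=> v P v1; exists (fun Y => enorm (Y - P) `^ mu) => Y YnP _.
  have r0 : 0 < enorm (Y - P) by rewrite enorm_gt0 // subr_eq0.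
  split; [| by rewrite !mul1r lexx|].
    apply: (@continuous_comp _ _ _ (fun Z : 'rV[R]_n => enorm (Z - P)) (fun x : R => x `^ mu)).
      exact: enorm_continuous.
    exact: powR_continuous.
  do 2 eexists; split; first exact: has_lap_enorm_powR.
  have nR : n%:R = 1 :> R by rewrite n1.
  by rewrite nR (_ : mu * (mu + 1 - 2) = - (mu * (1 - mu))) //; ring.
(* the exponent n makes the zero-homogeneous function subharmonic on every cone *)
pose N : R := n%:R.
have N2 : 2 <= N by rewrite /N (ler_nat R 2).
pose z : R := 2 `^ (- N).
have z0 : 0 < z by rewrite powR_gt0.
pose B : R := 1 + (1 - s) `^ (- N).
have B0 : 0 < B by rewrite ltr_wpDr // powR_ge0.
pose mu := Num.min m0 (Num.min 2^-1 (z / (2 * B * N))).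
have BN : 0 < 2 * B * N by rewrite mulr_gt0 ?mulr_gt0 //; lra.
have mu0 : 0 < mu by rewrite !lt_min m00 invr_gt0 divr_gt0 //=; lra.
have mu1 : mu < 1.
  apply: (@le_lt_trans _ _ 2^-1); [|lra].
  by rewrite /mu !ge_min lexx orbT.
have muz : mu * (2 * B * N) <= z.
  by rewrite -ler_pdivlMr // /mu !ge_min lexx !orbT.
exists mu; split; [by rewrite mu0|by rewrite ge_min lexx|].
exists 1, B, (z / 2); split=> //; first by rewrite divr_gt0.
move=> v P v1.
exists (fun Y => B * enorm (Y - P) `^ mu
   + -1 * (enorm (Y - P) `^ (mu + N) * cone_fun v P 1 Y `^ (- N))) => Y YnP tY.
have r0 : 0 < enorm (Y - P) by rewrite enorm_gt0 // subr_eq0.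
have tr : dotv v (Y - P) <= enorm (Y - P) by exact: dotv_le_enorm.
set r := enorm (Y - P) in r0 tr tY *.
set a := cone_fun v P 1 Y.
have aE : a = dotv v (Y - P) + r by rewrite /a /cone_fun mul1r.
have alo : (1 - s) * r <= a.
  by move: tY; rewrite aE; move: (dotv _ _) (r) => x y; clear; lra.
have a0 : 0 < a by apply: lt_le_trans alo; rewrite mulr_gt0 // subr_gt0.
have ahi : a <= 2 * r by move: tr; rewrite aE; clear; lra.
pose A := a / r.
have A0 : 0 < A by rewrite divr_gt0.
have aA : a = A * r by rewrite /A divfK // lt0r_neq0.
have A2 : A <= 2 by rewrite ler_pdivrMr.
have As : 1 - s <= A by rewrite ler_pdivlMr.
have AN1 : A `^ (- N) <= (1 - s) `^ (- N).
  by apply: powR_le_baseN => //; rewrite ?subr_gt0 //; lra.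
have AN2 : z <= A `^ (- N) by apply: powR_le_baseN => //; lra.
have aN x : a `^ x = A `^ x * r `^ x by rewrite aA powRM // ltW.
split.
- apply: (@continuousD _ _ _ (fun Z : 'rV[R]_n => B * enorm (Z - P) `^ mu)).
    apply: (@continuousM _ _ (cst B)); first exact: cst_continuous.
    apply: (@continuous_comp _ _ _ (fun Z : 'rV[R]_n => enorm (Z - P)) (fun x : R => x `^ mu)).
      exact: enorm_continuous.
    exact: powR_continuous.
  apply: (@continuousM _ _ (cst (-1))); first exact: cst_continuous.
  apply: (@continuousM _ _ (fun Z : 'rV[R]_n => enorm (Z - P) `^ (mu + N))).
    apply: (@continuous_comp _ _ _ (fun Z : 'rV[R]_n => enorm (Z - P))
      (fun x : R => x `^ (mu + N))).
      exact: enorm_continuous.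
    exact: powR_continuous.
  apply: (@continuous_comp _ _ _ (cone_fun v P 1) (fun x : R => x `^ (- N))).
    exact: cone_fun_continuous.
  exact: powR_continuous.
- rewrite -/r -/a aN.
  have -> : r `^ (mu + N) * (A `^ (- N) * r `^ (- N)) = A `^ (- N) * r `^ mu.
    by rewrite mulrCA -powRD_gt0 // addrK.
  rewrite mulN1r -mulrBl !ler_pM2r ?powR_gt0 // gerBl powR_ge0 andbT.
  by rewrite /B; move: AN1; clear; lra.
have h1 := has_lap_enorm_powR mu YnP.
have h2 := has_lap_enorm_powR (mu + N) YnP.
have h3 := has_lap_powR (- N) a0 (has_lap_cone v 1 YnP).
do 2 eexists; split.
  exact: has_lap_add (has_lap_scale B h1) (has_lap_scale (-1) (has_lap_mul h2 h3)).
rewrite cone_grad // -/a -/r dotvZl dotvZr cone_grad_radial // -/r -/N.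
have TE : dotv v (Y - P) / r = A - 1.
  by rewrite /A aE; field; exact: lt0r_neq0.
rewrite TE.
set W := r `^ (mu - 2); set X := A `^ (- N) in AN1 AN2 *.
pose Q := r `^ N.
have W0 : 0 < W by rewrite powR_gt0.
have Q0 : 0 < Q by rewrite powR_gt0.
have X0 : 0 < X by rewrite powR_gt0.
have r2 : r `^ 2 = r ^+ 2 by rewrite -powR_mulrn // ltW.
have E1 : r `^ (mu + N) = W * Q * r ^+ 2.
  by rewrite /W /Q -r2 -!powRD_gt0 //; congr (_ `^ _); ring.
have E2 : r `^ (mu + N - 1) = W * Q * r.
  rewrite (_ : mu + N - 1 = mu - 2 + N + 1); last by ring.
  by rewrite (powRD_gt0 (mu - 2 + N) 1) // (powRD_gt0 (mu - 2) N) // powRr1 // ltW.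
have E3 : r `^ (mu + N - 2) = W * Q.
  by rewrite /W /Q -!powRD_gt0 //; congr (_ `^ _); ring.
have F1 : a `^ (- N) = X / Q by rewrite aN (powRN r N).
have F2 : a `^ (- N - 1) = X / Q / (A * r).
  by rewrite (powRD_gt0 (- N) (-1)) // powR_inv1 ?(ltW a0) // F1 -aA.
have F3 : a `^ (- N - 2) = X / Q / (A * r) ^+ 2.
  by rewrite (powRD_gt0 (- N) (-2)) // (powRN a 2) powR_mulrn ?(ltW a0) // F1 -aA.
rewrite E1 E2 E3 F1 F2 F3.
pose E := N * (N + 3) / A - 2 * N * (mu + N) + (mu + N) * (mu + N + N - 2).
rewrite [leLHS](_ : _ = W * (B * (mu * (mu + N - 2)) - X * E)); last first.
  rewrite /E; field; rewrite ?lt0r_neq0 //.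
rewrite [leRHS]mulrC ler_pM2l //.
have EN : 1 <= E.
  have : N * (N + 3) / 2 <= N * (N + 3) / A.
    rewrite ler_wpM2l ?lef_pV2 ?posrE //.
    by rewrite mulr_ge0 //; move: N2; clear; lra.
  have : 2 * 1 <= N * (N - 1) by apply: ler_pM; move: N2; clear; lra.
  have : 0 <= (N - 2) * mu + mu ^+ 2.
    by rewrite addr_ge0 ?sqr_ge0 // mulr_ge0 ?(ltW mu0) // subr_ge0.
  by rewrite /E; clear; lra.
have : X * 1 <= X * E by rewrite ler_pM2l.
have : B * (mu * (mu + N - 2)) <= z / 2.
  apply: (@le_trans _ _ (B * (mu * N))).
    rewrite ler_pM2l // ler_pM2l //; move: mu1; clear; lra.
  by move: muz; clear; lra.
by move: AN2; clear; lra.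
Qed.

Lemma closure_ball_ge (R : realType) n (Om : set 'rV[R]_n) (h : 'rV[R]_n -> R) P rho Y :
  continuous h -> (forall X, Om X -> eball P rho X -> 0 <= h X) ->
  closure Om Y -> eball P rho Y -> 0 <= h Y.
Proof.
move=> ch hO cY YP; rewrite leNgt; apply/negP => hY.
have n1 := near_in_eball YP.
have n2 : \forall Z \near Y, h Z < 0 by exact: (@near_gt_continuous R _ h 0 Y (ch Y) hY).
have [Z [OZ [ZP hZ]]] := cY _ (filterI n1 n2).
by have := hO Z OZ ZP; rewrite leNgt hZ.
Qed.

(** The barrier is singular at its apex, so the comparison is made outside a
    small ball around the apex, where [u] is small because it vanishes on the
    boundary. *)
Lemma barrier_upper_bound (R : realType) n (gamma Lambda beta s : R)
    (Om : set 'rV[R]_n) (f u : 'rV[R]_n -> R) :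
  0 < gamma -> 0 <= beta -> beta * (1 + gamma) <= 2 -> cone_barrier n beta s ->
  open Om -> bounded_set Om -> (forall X, Om X -> 0 <= f X <= Lambda) ->
  solution gamma Om f u ->
  forall rho : R, 0 < rho -> exists C : R, forall P v,
    boundary Om P -> enorm v = 1 ->
    (forall X, Om X -> eball P rho X -> - s * enorm (X - P) <= dotv v (X - P)) ->
    forall X, Om X -> u X <= C * enorm (X - P) `^ beta.
Proof.
move=> g0 b0 bg [c1 [c2 [c3 [c10 c20 c30 hb]]]] oO bO hf su rho rho0.
have [M M0 hM] := solution_bounded bO su.
pose r1 := Num.min (rho / 2) 1.
have r10 : 0 < r1 by rewrite lt_min divr_gt0 //=; lra.
have r11 : r1 <= 1 by rewrite ge_min lexx orbT.
have r1r : r1 < rho by rewrite gt_min; apply/orP; left; lra.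
have rb0 : 0 < c1 * r1 `^ beta by rewrite mulr_gt0 // powR_gt0.
pose k := `|Lambda| * c1 `^ (- gamma).
have k0 : 0 <= k by rewrite mulr_ge0 // powR_ge0.
pose A := 1 + M / (c1 * r1 `^ beta) + k / c3.
have t1 : 0 <= M / (c1 * r1 `^ beta) by rewrite divr_ge0 // ltW.
have t2 : 0 <= k / c3 by rewrite divr_ge0 // ltW.
have A1 : 1 <= A by rewrite /A; move: t1 t2; clear; lra.
have A0 : 0 < A by apply: lt_le_trans A1.
have AM : M <= A * (c1 * r1 `^ beta).
  by rewrite -ler_pdivrMr // /A; move: t1 t2; clear; lra.
have Ak : k < A * c3.
  by rewrite -ltr_pdivrMr // /A; move: t1 t2; clear; lra.
exists (A * c2 + M / r1 `^ beta) => P v bP v1 hcone X OX.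
have [b hbP] := hb v P v1.
have [_ cu up _ u0] := su.
have rX0 : 0 <= enorm (X - P) `^ beta by exact: powR_ge0.
have XP : X != P.
  by apply/eqP => XP; apply: (boundary_notin oO bP); rewrite -XP.
have pX : 0 < enorm (X - P) by rewrite enorm_gt0 // subr_eq0.
have tc Y : closure Om Y -> enorm (Y - P) <= r1 ->
    - s * enorm (Y - P) <= dotv v (Y - P).
  move=> cY Yr; suff : 0 <= cone_fun v P s Y.
    by rewrite /cone_fun; move: (dotv _ _) (enorm _) => x y; clear; lra.
  apply: (@closure_ball_ge R n Om (cone_fun v P s) P rho Y) => //.
  - exact: cone_fun_continuous.
  - move=> Z OZ ZP; have := hcone Z OZ ZP; rewrite /cone_fun.
    by move: (dotv _ _) (enorm _) => x y; clear; lra.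
  - exact: le_lt_trans Yr r1r.
have inner e : 0 < e -> enorm (X - P) <= r1 -> u X <= A * b X + e.
  move=> e0 Xr.
  have [d d0 hd] : exists2 d : R, 0 < d & forall Z, eball P d Z -> closure Om Z -> u Z < e.
    have := cu; move/subspace_continuousP => /(_ P bP.1) cuP.
    have := cuP _ (lt_nbhsl (_ : u P < e)); rewrite u0 // => /(_ e0) hn.
    have : \forall Z \near P, closure Om Z -> u Z < e by exact: hn.
    by move/near_eball => [d d0 hd]; exists d.
  pose dl := Num.min (d / 2) (enorm (X - P)).
  have dl0 : 0 < dl by rewrite lt_min divr_gt0.
  have dld : dl < d by rewrite gt_min; apply/orP; left; move: d0; clear; lra.
  have dlX : dl <= enorm (X - P) by rewrite ge_min lexx orbT.
  pose K := closure Om `&` ([set Y | enorm (Y - P) <= r1]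
     `&` [set Y | - enorm (Y - P) <= - dl]).
  have Kin Y : K Y -> [/\ Y != P, 0 < enorm (Y - P) & - s * enorm (Y - P) <= dotv v (Y - P)].
    move=> [cY [/= Yr Yd]]; have rY : 0 < enorm (Y - P).
      by apply: lt_le_trans dl0 _; rewrite -lerN2.
    split => //; last exact: tc.
    by apply: contraTneq rY => ->; rewrite subrr enorm0 ltxx.
  apply: (@comparison_super R n gamma Lambda Om K f u (fun Y => A * b Y + e)) => //.
  - apply: (@subclosed_compact _ _ [set Y | enorm (Y - P) <= r1]).
    + apply: closedI; first exact: closed_closure.
      apply: closedI; first exact: (@closed_le_continuous R _
         (fun Y : 'rV[R]_n => enorm (Y - P)) r1 (@enorm_continuous R n P)).
      apply: (@closed_le_continuous R _ (fun Y : 'rV[R]_n => - enorm (Y - P))) => Y.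
      apply: (@continuousN R R _ (fun Z : 'rV[R]_n => enorm (Z - P))).
      exact: enorm_continuous.
    + exact: closed_eball_compact.
    + by move=> Y [_ []].
  - by move=> Y [].
  - apply: within_continuous_of => Y /Kin[YP rY tY]; have [cb _ _] := hbP Y YP tY.
    apply: (@continuousD _ _ _ (fun Z => A * b Z)); last exact: cst_continuous.
    by apply: (@continuousM _ _ (cst A)); [exact: cst_continuous|exact: cb].
  - move=> Y KY wu; have [YP rY tY] := Kin Y KY.
    have [cY [/= Yr Yd]] := KY.
    have [cb /andP[b1 b2] [g [l [hl ll]]]] := hbP Y YP tY.
    have rb : 0 < enorm (Y - P) `^ beta by rewrite powR_gt0.
    have bY : 0 < b Y by apply: lt_le_trans b1; rewrite mulr_gt0.
    have Ab : 0 < A * b Y by rewrite mulr_gt0.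
    have AY : A * (c1 * enorm (Y - P) `^ beta) <= A * b Y by rewrite ler_pM2l.
    have OY : Om Y.
      case: (closure_boundary oO cY) => // /u0 uY; rewrite uY in wu.
      by move: wu Ab e0; clear; lra.
    have Yr' : enorm (Y - P) < r1.
      rewrite lt_neqAle Yr andbT; apply/eqP => YE.
      rewrite YE in AY; have := hM Y cY.
      by move: wu AM AY e0; clear; lra.
    have Yd' : dl < enorm (Y - P).
      rewrite ltNge; apply/negP => Yd'.
      have := hd Y (le_lt_trans Yd' dld) cY.
      by move: wu Ab; clear; lra.
    have w0 : 0 < A * b Y + e by rewrite addr_gt0.
    split => //.
      have n1 := near_in_eball Yr'.
      have n2 : \forall Z \near Y, dl < enorm (Z - P).
        exact: (@near_lt_continuous R _ (fun Z : 'rV[R]_n => enorm (Z - P)) dl Y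
                 (@enorm_continuous R n P Y) Yd').
      have n3 : \forall Z \near Y, Om Z by exact: open_nbhs_nbhs.
      apply: filterS3 n1 n2 n3 => Z z1 z2 z3; split; first exact: subset_closure.
      by split; rewrite /= ?lerN2 ltW.
    do 2 eexists; split; first exact: has_lap_add (has_lap_scale A hl) (has_lap_cst e Y).
    have pw : (A * b Y + e) `^ (- gamma)
        <= c1 `^ (- gamma) * enorm (Y - P) `^ (beta - 2).
      apply: (@le_trans _ _ ((c1 * enorm (Y - P) `^ beta) `^ (- gamma))).
        apply: powR_le_baseN; [exact: ltW|exact: mulr_gt0|].
        apply: le_trans b1 _; apply: (@le_trans _ _ (A * b Y)).
          by rewrite ler_peMl // ltW.
        by rewrite lerDl ltW.
      rewrite powRM; [|exact: ltW|exact: ltW].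
      have cg : 0 < c1 `^ (- gamma) by apply: powR_gt0.
      rewrite (ler_pM2l cg) -powRrM.
      apply: ger_powR; first by rewrite rY /=; exact: le_trans Yr r11.
      by move: bg; clear; lra.
    apply: (@le_lt_trans _ _ (k * enorm (Y - P) `^ (beta - 2))).
      rewrite /k -mulrA; apply: (@le_trans _ _ (`|Lambda| * (A * b Y + e) `^ (- gamma))).
        by rewrite ler_wpM2r ?powR_ge0 // ler_norm.
      by rewrite ler_wpM2l.
    rewrite addr0; apply: (@lt_le_trans _ _ (A * c3 * enorm (Y - P) `^ (beta - 2))).
      have rb2 : 0 < enorm (Y - P) `^ (beta - 2) by apply: powR_gt0.
      by rewrite (ltr_pM2r rb2); exact: Ak.
    by rewrite -mulrN -mulrA ler_pM2l // lerNr -mulNr.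
  - split; first exact: subset_closure.
    by split; rewrite /= ?lerN2.
have [Xr|Xr] := leP (enorm (X - P)) r1.
  have tX := tc X (subset_closure OX) Xr.
  have [_ /andP[_ b2] _] := hbP X XP tX.
  apply: (@le_trans _ _ (A * (c2 * enorm (X - P) `^ beta))).
    apply: (@le_trans _ _ (A * b X)); last by rewrite ler_pM2l.
    by apply/ler_addgt0Pr => e e0; exact: inner.
  by rewrite mulrA ler_wpM2r // lerDl divr_ge0 ?powR_ge0 // ltW.
apply: le_trans (hM X (subset_closure OX)) _.
apply: (@le_trans _ _ (M / r1 `^ beta * enorm (X - P) `^ beta)).
  rewrite -[leLHS](@divfK _ (r1 `^ beta)) ?lt0r_neq0 ?powR_gt0 //.
  by rewrite ler_pM2l ?divr_gt0 ?powR_gt0 // powR_le_base // ltW.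
by rewrite ler_wpM2r // lerDr mulr_ge0 // ltW.
Qed.

(** * Distance to the boundary *)

Lemma first_exit (R : realType) n (Om : set 'rV[R]_n) (X v : 'rV[R]_n) (T : R) :
  open Om -> Om X -> 0 < T -> ~ Om (X + T *: v) ->
  exists2 s : R, 0 < s <= T & boundary Om (X + s *: v).
Proof.
move=> oO OX T0 nO.
pose E := [set s : R | 0 <= s /\ ~ Om (X + s *: v)].
have ET : E T by split => //; exact: ltW.
have hE : has_inf E.
  by split; [exists T | exists 0 => s []].
pose s0 := inf E.
have s00 : 0 <= s0 by apply: lb_le_inf; [exists T|move=> s []].
have s0T : s0 <= T by apply: ge_inf => //; exact: hE.2.
have before s : 0 <= s -> s < s0 -> Om (X + s *: v).
  move=> sp ss; apply: contrapT => nOs; move: ss; apply/negP; rewrite -leNgt.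
  by apply: ge_inf; [exact: hE.2|split].
have shift s : X + s0 *: v + s *: v = X + (s0 + s) *: v.
  by rewrite -addrA -scalerDl.
have nO0 : ~ Om (X + s0 *: v).
  move=> O0; have : \forall Y \near X + s0 *: v, Om Y by exact: open_nbhs_nbhs.
  move/(near_line v)/near_norm => [e e0 he].
  have [s [sp nOs] ss] := inf_adherent e0 hE.
  have sl : s0 <= s by apply: ge_inf; [exact: hE.2|split].
  apply: nOs; have := he (s - s0); rewrite shift addrCA subrr addr0; apply.
  by rewrite subr0 ger0_norm ?subr_ge0 // ltrBlDl.
have s0p : 0 < s0.
  rewrite lt_neqAle s00 andbT; apply/eqP => s00'.
  by apply: nO0; rewrite -s00' scale0r addr0.
exists s0; first by rewrite s0p.
split; last by move/interior_subset.
move=> S nS; have := nS : \forall Y \near X + s0 *: v, S Y.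
move/(near_line v)/near_norm => [e e0 he].
pose q := Num.min (e / 2) s0.
have q0 : 0 < q by rewrite lt_min divr_gt0.
have q1 : q <= e / 2 by rewrite ge_min lexx.
have q2 : q <= s0 by rewrite ge_min lexx orbT.
exists (X + (s0 - q) *: v); split.
  by apply: before; [rewrite subr_ge0|rewrite gtrBl].
rewrite -shift; apply: he; rewrite subr0 normrN gtr0_norm //.
by move: q1 e0; clear; lra.
Qed.

Lemma boundary_nonempty (R : realType) m (Om : set 'rV[R]_m.+1) :
  open Om -> bounded_set Om -> Om !=set0 -> boundary Om !=set0.
Proof.
move=> oO bO [X OX]; have [M M0 hM] := closure_bounded bO.
pose e : 'rV[R]_m.+1 := delta_mx 0 0; pose T := 2 * M + 1.
have T0 : 0 < T by rewrite /T; lra.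
have [|s _ bs] := @first_exit R _ Om X e T oO OX T0; last by exists (X + s *: e).
move=> /(@subset_closure _ Om)/hM h; have hX := hM X (subset_closure OX).
have : enorm (T *: e) = T by rewrite enormZ enorm_delta mulr1 gtr0_norm.
have := enorm_dist (X + T *: e) 0 X.
rewrite (addrC X) addrK subr0 sub0r enormN (addrC _ X) => h2 hT.
by move: h hX h2; rewrite hT /T; clear; lra.
Qed.

Lemma dist_le (R : realType) n (X Y : 'rV[R]_n) (A : set 'rV[R]_n) :
  A Y -> dist X A <= enorm (X - Y).
Proof.
move=> AY; apply: ge_inf; last by exists Y.
by exists 0 => _ [Z _ <-]; exact: enorm_ge0.
Qed.

Lemma dist_ge0 (R : realType) n (X : 'rV[R]_n) (A : set 'rV[R]_n) :
  A !=set0 -> 0 <= dist X A.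
Proof.
move=> [Y AY]; apply: lb_le_inf; first by exists (enorm (X - Y)), Y.
by move=> _ [Z _ <-]; exact: enorm_ge0.
Qed.

Lemma dist_attained (R : realType) n (X : 'rV[R]_n) (A : set 'rV[R]_n) :
  compact A -> A !=set0 -> exists2 P, A P & dist X A = enorm (X - P).
Proof.
move=> cA A0.
have [|P] := @EVT_min_rV R n (fun Y => enorm (Y - X)) A A0 cA.
  by apply: within_continuous_of => Y _; exact: enorm_continuous.
rewrite inE => AP hP; exists P => //; apply/eqP; rewrite eq_le dist_le //=.
apply: lb_le_inf; first by exists (enorm (X - P)), P.
by move=> _ [Z AZ <-]; rewrite enormC (enormC X) hP // inE.
Qed.

Lemma eball_dist_subset (R : realType) n (Om : set 'rV[R]_n) X :
  open Om -> Om X -> eball X (dist X (boundary Om)) `<=` Om.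
Proof.
move=> oO OX Y YX; apply: contrapT => nOY.
have [|s /andP[s0 s1] bs] := @first_exit R n Om X (Y - X) 1 oO OX ltr01.
  by rewrite scale1r addrC subrK.
have := dist_le X bs; apply/negP; rewrite -ltNge; apply: le_lt_trans YX.
rewrite -enormN opprB (addrC X) addrK enormZ gtr0_norm // ler_piMl //.
exact: enorm_ge0.
Qed.

Lemma convex_set_segment (R : realType) n (A : set 'rV[R]_n) x y (k : R) :
  convex_set A -> A x -> A y -> 0 <= k <= 1 -> A (k *: x + (1 - k) *: y).
Proof.
move=> cA Ax Ay /andP[k0 k1].
by have := cA x y (Itv01 k0 k1) (mem_set Ax) (mem_set Ay); rewrite inE.
Qed.

Lemma dotv_descent (R : realType) n (Z z : 'rV[R]_n) (s : R) :
  0 < s -> dotv Z z < 0 -> s * dotv z z <= - dotv Z z ->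
  dotv (Z + s *: z) (Z + s *: z) < dotv Z Z.
Proof.
move=> s0 tz sq; rewrite !dotvE (dotvC z).
have : s * (s * dotv z z) <= s * - dotv Z z by rewrite ler_pM2l.
have : s * dotv Z z < 0 by rewrite pmulr_rlt0.
by move: (dotv Z Z) (dotv Z z) (dotv z z) => x y w; clear; lra.
Qed.

(** At a nearest boundary point, a convex domain lies on the inner side of the
    hyperplane orthogonal to the shortest segment: otherwise that point would be
    a convex combination of two points of the domain. *)
Lemma convex_supporting (R : realType) n (Om : set 'rV[R]_n) X P :
  open Om -> convex_set Om -> Om X -> boundary Om P ->
  dist X (boundary Om) = enorm (X - P) ->
  forall Y, Om Y -> 0 <= dotv (X - P) (Y - P).
Proof.
move=> oO cO OX bP dE.
have XP : X - P != 0.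
  rewrite subr_eq0; apply/eqP => XP; apply: (boundary_notin oO bP).
  by rewrite -XP.
have d0 : 0 < enorm (X - P) by rewrite enorm_gt0.
suff strict Y : Om Y -> ~ dotv (X - P) (Y - P) < 0.
  move=> Y OY; rewrite leNgt; apply/negP; exact: strict.
move=> OY; set z := Y - P => tz.
pose q := dotv z z.
have q0 : 0 <= q by exact: dotv_ge0.
pose s := - dotv (X - P) z / (q + 1).
have s0 : 0 < s by rewrite divr_gt0 ?oppr_gt0 // ltr_wpDl.
pose W := P - s *: z.
have OW : Om W.
  apply: (eball_dist_subset oO OX); rewrite /eball /= dE.
  rewrite enormC lt_enorm_sqr ?enorm_ge0 // enorm_sqr.
  have -> : X - W = X - P + s *: z by rewrite /W opprB addrA addrAC.
  have sq : s * q <= - dotv (X - P) z.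
    by rewrite /s mulrAC ler_pdivrMr ?ltr_wpDl // ler_pM2l ?oppr_gt0 // lerDl.
  exact: dotv_descent.
apply: (boundary_notin oO bP).
have s1 : 0 < 1 + s by lra.
have -> : P = (1 + s)^-1 *: W + (1 - (1 + s)^-1) *: Y.
  have -> : 1 - (1 + s)^-1 = (1 + s)^-1 * s by field; exact: lt0r_neq0.
  rewrite -scalerA -scalerDr /W /z scalerBr opprB addrA subrK.
  have -> : P + s *: P = (1 + s) *: P by rewrite scalerDl scale1r.
  by rewrite scalerA mulVf ?scale1r // lt0r_neq0.
apply: convex_set_segment => //; apply/andP; split; first by rewrite invr_ge0 ltW.
by rewrite invf_le1 // lerDl ltW.
Qed.

(** * Domains above graphs *)

Lemma dotv_split_max (R : realType) m (y w : 'rV[R]_m.+1) :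
  dotv y w = y 0 ord_max * w 0 ord_max
             + dotv (col' ord_max y) (col' ord_max w).
Proof.
rewrite /dotv (bigD1_ord ord_max) //=; congr (_ + _).
by apply: eq_bigr => i _; rewrite !mxE.
Qed.

Lemma enorm_col' (R : realType) m (y : 'rV[R]_m.+1) :
  enorm (col' ord_max y) <= enorm y.
Proof.
rewrite le_enorm_sqr ?enorm_ge0 // enorm_sqr (dotv_split_max y) lerDr.
by rewrite -expr2 sqr_ge0.
Qed.

Lemma dotv_adjoint (R : realType) n (Q : 'M[R]_n) (w Z : 'rV[R]_n) :
  dotv (w *m Q^T) Z = dotv w (Z *m Q).
Proof.
have dE (x y : 'rV[R]_n) : dotv x y = (x *m y^T) 0 0.
  by rewrite mxE; apply: eq_bigr => i _; rewrite mxE.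
by rewrite !dE trmx_mul mulmxA.
Qed.

Lemma enorm_mul_orthogonalT (R : realType) n (Q : 'M[R]_n) (w : 'rV[R]_n) :
  Q *m Q^T = 1%:M -> enorm (w *m Q^T) = enorm w.
Proof. by move=> QQ; apply: orthogonal_enorm; rewrite trmxK; exact: mulmx1C. Qed.

Lemma col'B (R : realType) m (x y : 'rV[R]_m.+1) :
  col' ord_max (x - y) = col' ord_max x - col' ord_max y.
Proof. by apply/rowP => i; rewrite !mxE. Qed.

(** The cosine of the opening of the cone [t >= - L c], with a rational bound in
    place of the square root. *)
Lemma lipschitz_cosine (R : realType) (L t c r : R) :
  0 <= c -> 0 <= r -> r ^+ 2 = t ^+ 2 + c ^+ 2 -> - (L * c) <= t ->
  - (1 - (2 * (1 + L ^+ 2))^-1) * r <= t.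
Proof.
move=> c0 r0 rE tL.
have L1 : 0 < 1 + L ^+ 2 by rewrite ltr_pwDl // sqr_ge0.
pose x := (1 + L ^+ 2)^-1.
have x0 : 0 < x by rewrite invr_gt0.
have x1 : x <= 1 by rewrite invf_le1 // lerDl sqr_ge0.
have xL : x * (1 + L ^+ 2) = 1 by rewrite mulVf // lt0r_neq0.
have -> : (2 * (1 + L ^+ 2))^-1 = x / 2 by rewrite invfM mulrC.
set s := 1 - x / 2.
have s0 : 0 <= s by rewrite /s; lra.
have [t0|t0] := leP 0 t.
  by apply: le_trans t0; rewrite mulNr oppr_le0 mulr_ge0.
rewrite mulNr lerNl -ler_sqr ?nnegrE ?mulr_ge0 ?oppr_ge0 ?(ltW t0) //.
rewrite sqrrN.
have h1 : t ^+ 2 <= L ^+ 2 * c ^+ 2.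
  rewrite -exprMn -sqrrN ler_sqr ?nnegrE ?oppr_ge0 ?(ltW t0) //; last first.
    by apply: le_trans (_ : - t <= _); rewrite ?oppr_ge0 ?(ltW t0) // lerNl.
  by rewrite lerNl.
have h2 : t ^+ 2 <= (1 - x) * r ^+ 2.
  have : x * (t ^+ 2 * (1 + L ^+ 2)) <= x * (L ^+ 2 * r ^+ 2).
    rewrite ler_pM2l // rE mulrDr; move: h1; clear; lra.
  rewrite mulrCA xL mulr1 => /le_trans; apply.
  by rewrite mulrA (_ : x * L ^+ 2 = 1 - x) // -xL; ring.
apply: (le_trans h2); rewrite exprMn ler_wpM2r ?sqr_ge0 //.
by rewrite /s; have := sqr_ge0 x; move: (x0); clear; nra.
Qed.

Lemma lipschitz_cone (R : realType) m (Om : set 'rV[R]_m.+1) P (L : R) :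
  graph_near Om P (lipschitz_graph L) ->
  exists v d, [/\ enorm v = 1, 0 < d & forall P' X,
    boundary Om P' -> Om X -> eball P d P' -> eball P d X ->
    - (1 - (2 * (1 + L ^+ 2))^-1) * enorm (X - P') <= dotv v (X - P')].
Proof.
move=> [Q [r [g [QQ r0 gL hg]]]].
exists (delta_mx 0 ord_max *m Q^T), r; split => //.
  by rewrite enorm_mul_orthogonalT // enorm_delta.
move=> P' X bP' OX P'r Xr; rewrite dotv_adjoint.
have [_ [/(_ bP') gP' _]] := hg P' P'r.
have [[/(_ OX) gX _] _] := hg X Xr.
have yr Z : eball P r Z -> eball 0 r (col' ord_max ((Z - P) *m Q)).
  rewrite /eball /= subr0; apply: le_lt_trans.
  by apply: le_trans (enorm_col' _) _; rewrite orthogonal_enorm.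
have := gL _ _ (yr X Xr) (yr P' P'r).
have yE : (X - P') *m Q = (X - P) *m Q - (P' - P) *m Q.
  by rewrite -mulmxBl opprB addrA subrK.
rewrite -col'B -yE -(orthogonal_enorm (X - P') QQ).
set y := (X - P') *m Q in yE *.
have y1 : dotv (delta_mx 0 ord_max) y = y 0 ord_max.
  by rewrite dotvC dotv_delta.
rewrite y1 ler_norml => /andP[gl _].
apply: (@lipschitz_cosine _ _ _ (enorm (col' ord_max y))); rewrite ?enorm_ge0 //.
  by rewrite !enorm_sqr (dotv_split_max y) -expr2.
have yM : y 0 ord_max = ((X - P) *m Q) 0 ord_max - ((P' - P) *m Q) 0 ord_max.
  by rewrite yE !mxE.
by apply: le_trans gl _; rewrite yM gP' lerD2r ltW.
Qed.

(** Changing coordinates one at a time stays inside a box, where each step is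
    controlled by the mean value theorem and one partial derivative; so a [C^1]
    function is nearly linear around a point, uniformly over pairs of points. *)
Lemma C1_on_near_linear (R : realType) m (A : set 'rV[R]_m)
    (g : 'rV[R]_m -> R) p (e : R) :
  open A -> C1_on A g -> A p -> 0 < e ->
  exists2 d : R, 0 < d & forall x y, eball p d x -> eball p d y ->
    `|g y - g x - dotv (\row_i partial i g p) (y - x)| <= e * enorm (y - x).
Proof.
move=> oA cg Ap e0; pose a : 'rV[R]_m := \row_i partial i g p.
pose e1 := e / (m%:R + 1).
have m0 : 0 <= m%:R :> R by [].
have e10 : 0 < e1 by rewrite divr_gt0 // ltr_wpDl.
have me : m%:R * e1 <= e.
  by rewrite /e1 mulrA ler_pdivrMr ?ltr_wpDl // mulrC ler_pM2l // lerDl.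
have near_p : \forall Y \near p, A Y /\ forall i, `|partial i g Y - a 0 i| <= e1.
  have n1 : \forall Y \near p, A Y by exact: open_nbhs_nbhs.
  have n2 : \forall Y \near p, forall i, `|partial i g Y - a 0 i| <= e1.
    apply: (@filter_forall _ _ (fun i Y => `|partial i g Y - a 0 i| <= e1) (nbhs p)) => i.
    have [_ /(_ i)[_ ci]] := cg p Ap.
    have /(@cvgrPdist_le _ _ _ (nbhs p))/(_ e1 e10) h := ci.
    by apply: filterS h => Y; rewrite mxE distrC.
  by apply: filterS2 n1 n2.
have [d d0 hd] := near_norm near_p; exists d => // x y xp yp.
have {}xp : `|x - p| < d by apply: le_lt_trans xp; exact: normr_le_enorm.
have {}yp : `|y - p| < d by apply: le_lt_trans yp; exact: normr_le_enorm.
pose w k : 'rV[R]_m := \row_i (if (i < k)%N then y 0 i else x 0 i).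
have w0 : w 0%N = x by apply/rowP => i; rewrite !mxE.
have wm : w m = y by apply/rowP => i; rewrite !mxE ltn_ord.
have box (z : 'rV[R]_m) : (forall i, `|z 0 i - p 0 i| < d) -> `|z - p| < d.
  move=> h; rewrite [ltLHS]/Num.norm /= mx_normrE; apply/bigmax_ltP; split => //.
  by move=> [i j] _ /=; rewrite ord1 !mxE.
have coord (z : 'rV[R]_m) i : `|z - p| < d -> `|z 0 i - p 0 i| < d.
  by apply: le_lt_trans; have := le_coord_normr (z - p) i; rewrite !mxE.
suff path k : (k <= m)%N ->
    `|g (w k) - g x - dotv a (w k - x)| <= k%:R * e1 * enorm (y - x).
  have := path m (leqnn m); rewrite wm => /le_trans; apply.
  by rewrite ler_wpM2r ?enorm_ge0.
elim: k => [_|k IH km].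
  by rewrite w0 !subrr dotv0r subrr normr0 !mul0r.
pose i : 'I_m := Ordinal km; pose c := y 0 i - x 0 i.
pose phi th := g (w k + (th * c) *: delta_mx 0 i).
have wS : w k.+1 = w k + c *: delta_mx 0 i.
  apply/rowP => j; rewrite !mxE eqxx /= ltnS leq_eqVlt.
  have [->|ji] := eqVneq j i; first by rewrite eqxx ltnn mulr1 addrC subrK.
  have -> : (j == k :> nat) = false by apply/negbTE; apply: contraNneq ji => jk;
    apply/eqP/val_inj.
  by rewrite mulr0 addr0.
have inbox th : 0 <= th <= 1 -> `|w k + (th * c) *: delta_mx 0 i - p| < d.
  move=> /andP[t0 t1]; apply: box => j; rewrite !mxE eqxx /=.
  have [->|ji] := eqVneq j i; last by rewrite mulr0 addr0; case: ifP => _; exact: coord.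
  rewrite ltnn mulr1.
  have -> : x 0 i + th * c - p 0 i = (1 - th) * (x 0 i - p 0 i) + th * (y 0 i - p 0 i).
    by rewrite /c; ring.
  apply: le_lt_trans (ler_normD _ _) _; rewrite !normrM.
  rewrite (ger0_norm t0) ger0_norm ?subr_ge0 //.
  have xi := coord x i xp; have yi := coord y i yp.
  have [->|tn] := eqVneq th 0; first by rewrite subr0 mul0r mul1r addr0.
  have tp : 0 < th by rewrite lt_neqAle eq_sym tn.
  have h1 : (1 - th) * `|x 0 i - p 0 i| <= (1 - th) * d.
    by rewrite ler_wpM2l ?subr_ge0 // ltW.
  have h2 : th * `|y 0 i - p 0 i| < th * d by rewrite ltr_pM2l.
  by move: h1 h2; clear; lra.
have dphi (th : R) : 0 <= th <= 1 ->
    is_derive th (1 : R) phi (c * partial i g (w k + (th * c) *: delta_mx 0 i)).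
  move=> /inbox/hd[Aw _]; have [_ /(_ i)[di _]] := cg _ Aw.
  have l1 := line_is_derive di.
  have l2 : is_derive th (1 : R) (fun t : R => t * c) c.
    have := is_deriveM (is_derive_id th (1:R)) (is_derive_cst c th 1).
    by move/is_derive_eq; apply; rewrite scaler0 add0r [_ *: _]mulr1.
  have := is_derive_comp1 (phi := fun t : R => t * c) l2 l1.
  by move/is_derive_eq; apply; rewrite mulrC.
have cphi : {within `[0 : R, 1], continuous phi}.
  apply: derivable_within_continuous => th; rewrite in_itv /= => th01.
  by case: (dphi th th01).
have [th th01 E] := @MVT_segment R phi
    (fun th => c * partial i g (w k + (th * c) *: delta_mx 0 i)) 0 1 ler01
    (fun th h => dphi th (subset_itv_oo_cc h)) cphi.
have {}th01 : 0 <= th <= 1 by move: th01; rewrite in_itv.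
have [_ /(_ i) gi] := hd _ (inbox th th01).
rewrite subr0 mulr1 /phi mul1r mul0r scale0r addr0 -wS in E.
have -> : g (w k.+1) - g x - dotv a (w k.+1 - x)
    = (g (w k) - g x - dotv a (w k - x))
      + c * (partial i g (w k + (th * c) *: delta_mx 0 i) - a 0 i).
  have -> : w k.+1 - x = w k - x + c *: delta_mx 0 i by rewrite wS addrAC.
  by rewrite mulrBr -E (dotvDr (w k - x)) dotvZr dotv_delta; ring.
apply: le_trans (ler_normD _ _) _.
have -> : k.+1%:R * e1 * enorm (y - x)
    = k%:R * e1 * enorm (y - x) + e1 * enorm (y - x) by rewrite -natr1; ring.
apply: lerD; first exact: IH (ltnW km).
rewrite normrM mulrC.
apply: ler_pM => //; have := le_coord_enorm (y - x) i.
by rewrite !mxE.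
Qed.

(** Near any of its points, a [C^1] graph lies in a thin cone around one
    hyperplane, and this with the same axis for all apices on the graph nearby.
    Only the gradient of [g] at that point enters the axis. *)
Lemma C1_graph_flat (R : realType) m (Om : set 'rV[R]_m.+1) P0 :
  graph_near Om P0 (@C1_graph R m) ->
  exists2 r : R, 0 < r & forall P, boundary Om P -> eball P0 r P ->
  forall e : R, 0 < e -> exists v d, [/\ enorm v = 1, 0 < d &
    forall P' X, boundary Om P' -> eball P d P' -> eball P d X ->
      (Om X -> - e * enorm (X - P') <= dotv v (X - P')) /\
      (e * enorm (X - P') < dotv v (X - P') -> Om X)].
Proof.
move=> [Q [r [g [QQ r0 gC hg]]]]; exists r => // P bP Pr e e0.
have yr Z s Y : eball Z s Y ->
    eball (col' ord_max ((Z - P0) *m Q)) s (col' ord_max ((Y - P0) *m Q)).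
  rewrite /eball /=; apply: le_lt_trans; rewrite -col'B -mulmxBl.
  rewrite opprB addrA subrK.
  by apply: le_trans (enorm_col' _) _; rewrite orthogonal_enorm.
have yr0 Y : eball P0 r Y -> eball 0 r (col' ord_max ((Y - P0) *m Q)).
  move/yr; rewrite subrr mul0mx.
  by rewrite (_ : col' _ 0 = 0) //; apply/rowP => i; rewrite !mxE.
have [d1 d10 hd1] := C1_on_near_linear (@eball_open _ _ _ _) gC (yr0 P Pr) e0.
pose a : 'rV[R]_m := \row_i partial i g (col' ord_max ((P - P0) *m Q)).
pose w : 'rV[R]_m.+1 :=
  \row_i (if unlift ord_max i is Some j then - a 0 j else 1).
have wy y : dotv w y = y 0 ord_max - dotv a (col' ord_max y).
  rewrite dotv_split_max mxE unlift_none mul1r -dotvNl; congr (_ + dotv _ _).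
  by apply/rowP => j; rewrite !mxE liftK mxE.
pose N := w *m Q^T.
have N1 : 1 <= enorm N.
  rewrite enorm_mul_orthogonalT //; have := le_coord_enorm w ord_max.
  have -> : w 0 ord_max = 1 by rewrite mxE unlift_none.
  by rewrite normr1.
have N0 : 0 < enorm N by apply: lt_le_trans N1.
have [d2 d20 hd2] : exists2 d : R, 0 < d & forall Y, eball P d Y -> eball P0 r Y.
  exists (r - enorm (P - P0)); first by rewrite subr_gt0.
  move=> Y YP; rewrite /eball /= in YP *; apply: le_lt_trans (enorm_dist Y P P0) _.
  by move: YP; clear; lra.
exists ((enorm N)^-1 *: N), (Num.min d1 d2); split.
- by rewrite enormZ ger0_norm ?invr_ge0 ?(ltW N0) // mulVf // lt0r_neq0.
- by rewrite lt_min d10.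
move=> P' X bP'; rewrite /eball /= !lt_min => /andP[P'1 P'2] /andP[X1 X2].
have [_ [/(_ bP') gP' _]] := hg P' (hd2 _ P'2).
have [gX _] := hg X (hd2 _ X2).
have := hd1 _ _ (yr P d1 P' P'1) (yr P d1 X X1); rewrite -/a.
have yE : (X - P') *m Q = (X - P0) *m Q - (P' - P0) *m Q.
  by rewrite -mulmxBl opprB addrA subrK.
rewrite -col'B -yE; set y := (X - P') *m Q in yE *.
have eN : enorm (col' ord_max y) <= enorm (X - P').
  by rewrite -(orthogonal_enorm (X - P') QQ); exact: enorm_col'.
have yM : y 0 ord_max = ((X - P0) *m Q) 0 ord_max - ((P' - P0) *m Q) 0 ord_max.
  by rewrite yE !mxE.
have tE : enorm N * dotv ((enorm N)^-1 *: N) (X - P')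
    = y 0 ord_max - dotv a (col' ord_max y).
  by rewrite dotvZl mulrA mulfV ?lt0r_neq0 // mul1r dotv_adjoint wy.
move=> lin; have {}lin := le_trans lin (ler_wpM2l (ltW e0) eN).
move: lin; rewrite ler_norml => /andP[lo hi].
have eX : e * enorm (X - P') <= enorm N * (e * enorm (X - P')).
  by rewrite ler_peMl // mulr_ge0 ?enorm_ge0 // ltW.
split.
  move=> /gX gX'; rewrite -(ler_pM2l N0) tE yM gP' mulNr mulrN.
  by move: eX lo gX'; clear; lra.
rewrite -(ltr_pM2l N0) tE yM gP' => tX; apply/gX.
by move: eX hi tX; clear; lra.
Qed.

Lemma concave_graph_segment (R : realType) m (r : R) (g : 'rV[R]_m -> R) x y k :
  concave_graph r g -> eball 0 r x -> eball 0 r y -> 0 <= k <= 1 ->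
  k * g x + (1 - k) * g y <= g (k *: x + (1 - k) *: y).
Proof.
move=> cg rx ry /andP[k0 k1].
have := cg (Itv01 k0 k1) x y (mem_set rx) (mem_set ry).
rewrite -[leRHS]/(k * - g x + (1 - k) * - g y).
rewrite -[leLHS]/(- g (k *: x + (1 - k) *: y)).
by rewrite !mulrN -opprD lerN2.
Qed.

(** The complement of the domain is locally convex, so the hyperplane through a
    nearest boundary point, orthogonal to the shortest segment, separates it from
    the point: the domain contains a half-ball there, of uniform radius. *)
Lemma concave_interior_halfspace (R : realType) m (Om : set 'rV[R]_m.+1) :
  open Om -> boundary Om 0 -> graph_near Om 0 (@concave_graph R m) ->
  exists2 rho : R, 0 < rho & forall X P, Om X -> eball 0 rho X ->
    boundary Om P -> dist X (boundary Om) = enorm (X - P) ->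
    forall Y, eball P rho Y -> 0 < dotv (X - P) (Y - P) -> Om Y.
Proof.
move=> oO b0 [Q [r [g [QQ r0 cg hg]]]].
pose rho := r / 3; have rho0 : 0 < rho by rewrite divr_gt0.
have rE : r = rho + rho + rho by rewrite /rho; field.
exists rho => // X P OX Xr bP dE Y YP tY; apply: contrapT => nOY.
have XP : enorm (X - P) < rho by rewrite -dE; apply: le_lt_trans Xr; exact: dist_le.
have P0 : enorm (P - 0) < rho + rho.
  apply: le_lt_trans (enorm_dist P X 0) _; rewrite (enormC P).
  exact: ltrD.
have Br s : 0 <= s <= 1 -> eball 0 r (P + s *: (Y - P)).
  move=> /andP[s0 s1]; rewrite /eball /= (_ : _ - 0 = P - 0 + s *: (Y - P)); last first.
    by rewrite !subr0.
  rewrite rE; apply: le_lt_trans (enormD _ _) _; apply: ltrD => //.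
  rewrite enormZ ger0_norm //; apply: le_lt_trans YP; rewrite ler_piMl //.
  exact: enorm_ge0.
pose y Z : 'rV[R]_m.+1 := (Z - 0) *m Q.
have yr Z : eball 0 r Z -> eball 0 r (col' ord_max (y Z)).
  rewrite /eball /= => Zr; rewrite subr0; apply: le_lt_trans Zr.
  by apply: le_trans (enorm_col' _) _; rewrite orthogonal_enorm.
have out s : 0 <= s <= 1 -> ~ Om (P + s *: (Y - P)).
  move=> s01; have /andP[s0 s1] := s01.
  have Pr : eball 0 r P by have := Br 0; rewrite scale0r addr0; apply; rewrite lexx ler01.
  have Yr : eball 0 r Y.
    by have := Br 1; rewrite scale1r addrC subrK; apply; rewrite lexx ler01.
  have [_ [/(_ bP) gP _]] := hg P Pr.
  have [[_ gY] _] := hg Y Yr.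
  have {}gY : (y Y) 0 ord_max <= g (col' ord_max (y Y)).
    by rewrite leNgt; apply/negP => /gY.
  have [[gZ _] _] := hg _ (Br s s01).
  move/gZ; apply/negP; rewrite -leNgt -/(y _).
  have yE : y (P + s *: (Y - P)) = s *: y Y + (1 - s) *: y P.
    rewrite /y !subr0 !scalemxAl -mulmxDl; congr (_ *m _).
    by rewrite scalerBr scalerBl scale1r addrCA.
  have := concave_graph_segment cg (yr Y Yr) (yr P Pr) s01.
  have -> : s *: col' ord_max (y Y) + (1 - s) *: col' ord_max (y P)
      = col' ord_max (y (P + s *: (Y - P))).
    by rewrite yE; apply/rowP => i; rewrite !mxE.
  apply: le_trans.
  have -> : y (P + s *: (Y - P)) 0 ord_max
      = s * y Y 0 ord_max + (1 - s) * y P 0 ord_max by rewrite yE !mxE.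
  by rewrite lerD ?ler_wpM2l ?subr_ge0 // -gP.
pose q := dotv (P - Y) (P - Y).
have q0 : 0 <= q by exact: dotv_ge0.
have q1 : 0 < q + 1 by rewrite ltr_wpDl.
set t := dotv (X - P) (Y - P) in tY.
pose s := Num.min 1 (t / (q + 1)).
have s0 : 0 < s by rewrite lt_min ltr01 divr_gt0.
have s1 : s <= 1 by rewrite ge_min lexx.
have st : s <= t / (q + 1) by rewrite ge_min lexx orbT.
apply: (out s); first by rewrite (ltW s0).
apply: (eball_dist_subset oO OX); rewrite /eball /= dE enormC.
rewrite lt_enorm_sqr ?enorm_ge0 // enorm_sqr.
have -> : X - (P + s *: (Y - P)) = X - P + s *: (P - Y).
  by rewrite opprD addrA -scalerN opprB.
have tN : dotv (X - P) (P - Y) = - t by rewrite -(opprB Y) dotvNr.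
apply: dotv_descent => //; first by rewrite tN oppr_lt0.
rewrite tN opprK.
rewrite -/q; apply: (@le_trans _ _ (t / (q + 1) * q)).
  by rewrite ler_wpM2r.
by rewrite mulrAC ler_pdivrMr // ler_pM2l // lerDl.
Qed.

(** * Uniformity over the boundary *)

Lemma compact_uniform_bound (R : realType) (T : topologicalType) (K : set T)
    (Phi : T -> R -> Prop) :
  compact K -> (forall x c d, c <= d -> Phi x c -> Phi x d) ->
  (forall x, K x -> exists c, \forall y \near x, K y -> Phi y c) ->
  exists c, forall x, K x -> Phi x c.
Proof.
move=> /compact_near_coveringP/near_covering_withinP cK mono loc.
have h : \forall c \near (+oo : set_system R), K `<=` (Phi ^~ c).
  apply: (cK R +oo (fun c x => Phi x c)) => x Kx; have [c hc] := loc x Kx.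
  exists ([set y | K y -> Phi y c], [set d | c <= d]) => /=.
    by split => //; apply: nbhs_pinfty_ge; exact: num_real.
  by move=> [y d] /= [hy cd] Ky; apply: mono cd (hy Ky).
by have [c hc] := filter_ex h; exists c.
Qed.

(** A single axis serves all apices near a given boundary point, so that the
    constants of the barriers are locally, hence globally, bounded. *)
Definition uniform_exterior_cone (R : realType) n (Om : set 'rV[R]_n) (s : R) :
    Prop :=
  forall P, boundary Om P -> exists v d, [/\ enorm v = 1, 0 < d &
    forall P' X, boundary Om P' -> Om X -> eball P d P' -> eball P d X ->
      - s * enorm (X - P') <= dotv v (X - P')].

Lemma boundary_decay (R : realType) n (gamma Lambda beta s : R)
    (Om : set 'rV[R]_n) (f u : 'rV[R]_n -> R) :
  0 < gamma -> 0 <= beta -> beta * (1 + gamma) <= 2 -> cone_barrier n beta s ->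
  open Om -> bounded_set Om -> (forall X, Om X -> 0 <= f X <= Lambda) ->
  solution gamma Om f u -> uniform_exterior_cone Om s ->
  exists C : R, forall P X, boundary Om P -> Om X ->
    u X <= C * enorm (X - P) `^ beta.
Proof.
move=> g0 b0 bg hb oO bO hf su hc.
have [|||C hC] := @compact_uniform_bound R _ (boundary Om)
  (fun P C => forall X, Om X -> u X <= C * enorm (X - P) `^ beta).
- exact: boundary_compact.
- move=> P c d cd h X OX; apply: le_trans (h X OX) _.
  by rewrite ler_wpM2r // powR_ge0.
- move=> P bP; have [v [d [v1 d0 hd]]] := hc P bP.
  have d2 : 0 < d / 2 by rewrite divr_gt0.
  have [C hC] := barrier_upper_bound g0 b0 bg hb oO bO hf su d2.
  exists C; apply/near_eball; exists (d / 2) => // P' P'd bP' X OX.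
  apply: (hC P' v bP' v1 _ X OX) => Y OY YP'; apply: (hd P' Y bP' OY).
    by apply: lt_trans P'd _; rewrite ltr_pdivrMr // mulr_natr mulr2n ltrDl.
  apply: le_lt_trans (enorm_dist Y P' P) _.
  by rewrite [ltRHS](splitr d) ltrD.
by exists C => P X bP; apply: hC.
Qed.

(** * The estimates for solutions *)

(** The cone condition holds at nearest boundary points; since these realise the
    distance to the boundary, decay there implies decay towards all others. *)
Lemma convex_decay (R : realType) m (gamma Lambda beta : R)
    (Om : set 'rV[R]_m.+1) (f u : 'rV[R]_m.+1 -> R) :
  0 < gamma -> 0 < beta < 1 -> beta * (1 + gamma) <= 2 ->
  open Om -> bounded_set Om -> Om !=set0 -> convex_set Om ->
  (forall X, Om X -> 0 <= f X <= Lambda) -> solution gamma Om f u ->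
  exists C : R, forall P X, boundary Om P -> Om X ->
    u X <= C * enorm (X - P) `^ beta.
Proof.
move=> g0 /andP[b0 b1] bg oO bO O0 cO hf su.
have [s s0 hb] : exists2 s : R, 0 < s & cone_barrier m.+1 beta s.
  by apply: cone_barrier_flat; rewrite b0.
have [C hC] := barrier_upper_bound g0 (ltW b0) bg hb oO bO hf su ltr01.
exists `|C| => P' X bP' OX.
have [P bP dE] := dist_attained X (boundary_compact bO) (boundary_nonempty oO bO O0).
have XP : X != P by apply/eqP => XP; apply: (boundary_notin oO bP); rewrite -XP.
have d0 : 0 < enorm (X - P) by rewrite enorm_gt0 // subr_eq0.
apply: (@le_trans _ _ (`|C| * enorm (X - P) `^ beta)); last first.
  apply: ler_wpM2l; first exact: normr_ge0.
  apply: powR_le_base; [exact: ltW|exact: enorm_ge0|].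
  by rewrite -dE; exact: dist_le.
apply: (@le_trans _ _ (C * enorm (X - P) `^ beta)); last first.
  by rewrite ler_wpM2r ?powR_ge0 // ler_norm.
apply: (hC P ((enorm (X - P))^-1 *: (X - P)) bP _ _ X OX).
  by rewrite enormZ ger0_norm ?invr_ge0 ?(ltW d0) // mulVf // lt0r_neq0.
move=> Y OY _; rewrite dotvZl.
apply: (@le_trans _ _ 0); first by rewrite mulNr oppr_le0 mulr_ge0 ?enorm_ge0 // ltW.
by rewrite mulr_ge0 ?invr_ge0 ?(ltW d0) // (convex_supporting oO cO OX bP dE).
Qed.

Lemma C1_domain_decay (R : realType) m (gamma Lambda beta : R)
    (Om : set 'rV[R]_m.+1) (f u : 'rV[R]_m.+1 -> R) :
  0 < gamma -> 0 < beta < 1 -> beta * (1 + gamma) <= 2 ->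
  open Om -> bounded_set Om -> C1_domain Om ->
  (forall X, Om X -> 0 <= f X <= Lambda) -> solution gamma Om f u ->
  exists C : R, forall P X, boundary Om P -> Om X ->
    u X <= C * enorm (X - P) `^ beta.
Proof.
move=> g0 b01 bg oO bO cO hf su; have /andP[b0 _] := b01.
have [s s0 hb] := cone_barrier_flat m.+1 b01.
apply: (boundary_decay g0 (ltW b0) bg hb oO bO hf su) => P bP.
have [r r0 hr] := C1_graph_flat (cO P bP).
have [v [d [v1 d0 hd]]] := hr P bP (eball_center P r0) s s0.
exists v, d; split => // P' X bP' OX P'd Xd.
by have [h _] := hd P' X bP' P'd Xd; exact: h.
Qed.

Lemma dist_gt0 (R : realType) m (Om : set 'rV[R]_m.+1) X :
  open Om -> bounded_set Om -> Om X -> 0 < dist X (boundary Om).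
Proof.
move=> oO bO OX.
have O0 : Om !=set0 by exists X.
have [P bP ->] := dist_attained X (boundary_compact bO) (boundary_nonempty oO bO O0).
rewrite enorm_gt0 // subr_eq0; apply/eqP => XP.
by apply: (boundary_notin oO bP); rewrite -XP.
Qed.

Lemma asymp_dist (R : realType) m (gamma lambda C : R)
    (Om : set 'rV[R]_m.+1) (f u : 'rV[R]_m.+1 -> R) :
  0 < gamma -> 0 < lambda -> open Om -> bounded_set Om ->
  (forall X, Om X -> lambda <= f X) -> solution gamma Om f u ->
  (forall P X, boundary Om P -> Om X ->
     u X <= C * enorm (X - P) `^ (2 / (1 + gamma))) ->
  asymp Om u (fun X => dist X (boundary Om) `^ (2 / (1 + gamma))).
Proof.
move=> g0 l0 oO bO hf su hC; split.
  have [c c0 hc] := ball_lower_bound m.+1 g0 l0; exists c; split => // X OX.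
  apply: (hc Om f u X _ oO hf su); first exact: dist_gt0.
  exact: eball_dist_subset.
have C1 : 0 < `|C| + 1 by rewrite ltr_wpDl.
exists (`|C| + 1)^-1; split; first by rewrite invr_gt0.
move=> X OX; have O0 : Om !=set0 by exists X.
have [P bP ->] := dist_attained X (boundary_compact bO) (boundary_nonempty oO bO O0).
rewrite mulrC ler_pdivrMr // mulrC; apply: le_trans (hC P X bP OX) _.
rewrite ler_wpM2r ?powR_ge0 //; apply: le_trans (ler_norm _) _.
by rewrite lerDl.
Qed.

(** Moving from [X] against the axis of the cones, one leaves the domain at a
    boundary point [P'] such that [X] is on the axis of the cone with apex [P'],
    at a distance from [P'] no smaller than its distance to the boundary. *)
Lemma C1_graph_lower_bound (R : realType) m (gamma lambda : R)
    (Om : set 'rV[R]_m.+1) (f u : 'rV[R]_m.+1 -> R) :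
  0 < gamma -> 0 < lambda -> open Om -> bounded_set Om ->
  (forall X, Om X -> lambda <= f X) -> solution gamma Om f u ->
  boundary Om 0 -> graph_near Om 0 (@C1_graph R m) ->
  exists r : R, 0 < r /\ forall alpha : R, 1 < alpha ->
    gtrsim (Om `&` eball 0 r) u (fun X => dist X (boundary Om) `^ alpha).
Proof.
move=> g0 l0 oO bO hf su b0 /C1_graph_flat[r r0 hr].
have [c2u cu up eu ub] := su.
exists (r / 2); split; first by rewrite divr_gt0.
move=> alpha a1; have a0 : 0 <= alpha by lra.
have [s /andP[s0 s1] hs] := cone_lower_bound g0 l0 a1 oO hf su.
pose K := closure Om `&` [set X | enorm (X - 0) <= r / 2].
have dK X : K X -> dist X (boundary Om) <= r / 2.
  by move=> [_ /=]; apply: le_trans; exact: dist_le.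
have bne : boundary Om !=set0 by exists 0.
have [|||C hC] := @compact_uniform_bound R _ K
  (fun X C => Om X -> dist X (boundary Om) `^ alpha <= C * u X).
- apply: (@subclosed_compact _ _ (closure Om)).
  + apply: closedI; first exact: closed_closure.
    exact: (@closed_le_continuous R _ (fun Y : 'rV[R]_m.+1 => enorm (Y - 0))
      (r / 2) (@enorm_continuous R _ 0)).
  + exact: closure_compact.
  + by move=> X [].
- move=> X c d cd h OX; apply: le_trans (h OX) _.
  by rewrite ler_pM2r // up.
- move=> P [cP /= Pr]; case: (closure_boundary oO cP) => [OP|bP].
    have uP := up P OP.
    exists ((r / 2) `^ alpha / (u P / 2)).
    have cuP : {for P, continuous u} by case: c2u => /(_ P OP)[].
    have : \forall Y \near P, u P / 2 < u Y.
      by apply: (@near_lt_continuous R _ u _ P cuP); rewrite ltr_pdivrMr // ltr_pMr // ltr1n.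
    apply: filterS => Y uY KY OY.
    apply: (@le_trans _ _ ((r / 2) `^ alpha)).
      by rewrite powR_le_base ?dist_ge0 // dK.
    rewrite mulrAC ler_pdivlMr ?divr_gt0 // ler_wpM2l ?powR_ge0 //.
    exact: ltW.
  have Pr' : eball 0 r P.
    by apply: le_lt_trans Pr _; rewrite ltr_pdivrMr // ltr_pMr // ltr1n.
  have [v [d [v1 d0 hd]]] := hr P bP Pr' s s0.
  have d2 : 0 < d / 2 by rewrite divr_gt0.
  have [c c0 hc] := hs (d / 2) d2.
  pose e := d / 12; have e0 : 0 < e by rewrite divr_gt0.
  have dE : d = 12 * e by rewrite /e; field.
  exists c^-1; apply/near_eball; exists e => // X XP KX OX.
  rewrite /eball /= in XP.
  pose T := 3 * e; have T0 : 0 < T by rewrite mulr_gt0.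
  have far tau : 0 <= tau <= T -> enorm (X + tau *: - v - P) < 4 * e.
    move=> /andP[t0 t1]; rewrite addrAC; apply: le_lt_trans (enormD _ _) _.
    rewrite enormZ enormN v1 mulr1 ger0_norm //.
    by move: XP t1; rewrite /T; clear; lra.
  have [|tau /andP[t0 t1] bX] := @first_exit R _ Om X (- v) T oO OX T0.
    move=> OZ; have [] := hd P (X + T *: - v) bP (eball_center P d0).
      rewrite /eball /= dE; apply: lt_trans (far T _) _; first by rewrite lexx ltW.
      by rewrite ltr_pM2r // ltr_nat.
    move=> /(_ OZ) h _; move: h; apply/negP; rewrite -ltNge.
    have -> : X + T *: - v - P = X - P + T *: - v by rewrite addrAC.
    have /far : 0 <= T <= T by rewrite lexx ltW.
    rewrite addrAC => hf4.
    rewrite dotvDr dotvZr dotvNr -(enorm_sqr v) v1 expr1n mulrN mulr1.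
    have h1 := le_trans (dotv_le_enorm (X - P) v1) (ltW XP).
    have h2 : s * enorm (X - P + T *: - v) <= 4^-1 * (4 * e).
      by apply: ler_pM => //; [exact: ltW|exact: enorm_ge0|exact: ltW|exact: ltW].
    by move: h1 h2 e0; rewrite /T mulNr; clear; lra.
  set P' := X + tau *: - v in bX.
  have XE : X = P' + tau *: v by rewrite /P' scalerN subrK.
  have P'P : enorm (P' - P) < 4 * e by apply: far; rewrite ltW.
  apply: (@le_trans _ _ (tau `^ alpha)).
    rewrite powR_le_base ?dist_ge0 //; apply: le_trans (dist_le X bX) _.
    by rewrite {1}XE addrC addKr enormZ v1 mulr1 gtr0_norm.
  rewrite mulrC ler_pdivlMr // mulrC [in leRHS]XE; apply: hc => //.
  + by case: bX.
  + move=> Y YP' tY; apply: (hd P' Y bX _ _).2 => //.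
      by apply: lt_trans P'P _; rewrite dE ltr_pM2r // ltr_nat.
    apply: le_lt_trans (enorm_dist Y P' P) _.
    by move: YP' P'P e0; rewrite /eball /= dE; clear; lra.
  + rewrite t0; apply: le_trans t1 _; rewrite /T dE.
    by move: e0; clear; lra.
have C1 : 0 < `|C| + 1 by rewrite ltr_wpDl.
exists (`|C| + 1)^-1; split; first by rewrite invr_gt0.
move=> X [OX Xr]; rewrite mulrC ler_pdivrMr // mulrC.
have KX : K X by split; [exact: subset_closure|exact: ltW].
apply: le_trans (hC X KX OX) _; rewrite ler_pM2r ?up //.
by apply: le_trans (ler_norm _) _; rewrite lerDl.
Qed.

(** Every point close to the origin is on the inner normal of the half-ball that
    the domain contains at a nearest boundary point. *)
Lemma concave_graph_lower_bound (R : realType) m (gamma lambda : R)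
    (Om : set 'rV[R]_m.+1) (f u : 'rV[R]_m.+1 -> R) :
  0 < gamma -> 0 < lambda -> open Om -> bounded_set Om ->
  (forall X, Om X -> lambda <= f X) -> solution gamma Om f u ->
  boundary Om 0 -> graph_near Om 0 (@concave_graph R m) ->
  exists r : R, 0 < r /\
    gtrsim (Om `&` eball 0 r) u (fun X => dist X (boundary Om)).
Proof.
move=> g0 l0 oO bO hf su b0 cg.
have [rho rho0 hrho] := concave_interior_halfspace oO b0 cg.
have [c c0 hc] := halfspace_lower_bound (ltn0Sn m) g0 l0 oO hf su rho0.
have rho2 : rho / 2 < rho by rewrite ltr_pdivrMr // ltr_pMr // ltr1n.
exists (rho / 2); split; first by rewrite divr_gt0.
exists c; split => // X [OX Xr].
have bne : boundary Om !=set0 by exists 0.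
have [P bP dE] := dist_attained X (boundary_compact bO) bne.
have d0 : 0 < enorm (X - P) by rewrite -dE; exact: dist_gt0.
have dr : enorm (X - P) <= rho / 2.
  by rewrite -dE; apply: le_trans (dist_le X b0) _; exact: ltW.
set v := (enorm (X - P))^-1 *: (X - P).
have XE : X = P + enorm (X - P) *: v.
  by rewrite /v scalerA mulfV ?lt0r_neq0 // scale1r addrC subrK.
rewrite dE [in leRHS]XE; apply: hc.
- by rewrite /v enormZ ger0_norm ?invr_ge0 ?(ltW d0) // mulVf // lt0r_neq0.
- move=> Y YP tY; apply: (hrho X P OX _ bP dE Y YP).
    exact: lt_trans Xr rho2.
  by move: tY; rewrite /v dotvZl pmulr_rgt0 // invr_gt0.
- by rewrite d0.
Qed.

Lemma lipschitz_with_lip_const (R : realType) m (Om : set 'rV[R]_m.+1) :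
  (exists L, lipschitz_with Om L) ->
  0 <= lip_const Om /\ exists2 L, lipschitz_with Om L & L <= lip_const Om + 1.
Proof.
move=> [L0 hL0].
have hi : has_inf [set L | lipschitz_with Om L].
  by split; [exists L0|exists 0 => L []].
split; first by apply: lb_le_inf; [exists L0|move=> L []].
by have [L hL lL] := inf_adherent ltr01 hi; exists L => //; exact: ltW.
Qed.

Lemma lipschitz_exterior_cone (R : realType) m (Om : set 'rV[R]_m.+1) (L L' : R) :
  lipschitz_with Om L -> L <= L' ->
  uniform_exterior_cone Om (1 - (2 * (1 + L' ^+ 2))^-1).
Proof.
move=> [_ hL] LL' P bP; apply: lipschitz_cone.
have [Q [r [g [QQ r0 gL hg]]]] := hL P bP; exists Q, r, g; split => // x y rx ry.
by apply: le_trans (gL x y rx ry) _; rewrite ler_wpM2r // enorm_ge0.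
Qed.

(** The constant [lip_const] is an infimum that need not be attained, whence the
    cones of slope [L + 1]. *)
Lemma lipschitz_exponent (R : realType) n (gamma L : R) : (0 < n)%N ->
  exists mu : R, 0 < gamma -> 0 <= L ->
    [/\ 0 < mu < 1, mu * (1 + gamma) <= 2 &
        cone_barrier n mu (1 - (2 * (1 + (L + 1) ^+ 2))^-1)].
Proof.
move=> n0; have [g0|g0] := ltP 0 gamma; last by exists 0.
have [L0|L0] := leP 0 L; last by exists 0.
have g1 : 0 < 1 + gamma by lra.
have sq : 0 <= (L + 1) ^+ 2 by exact: sqr_ge0.
have x0 : 0 < 2 * (1 + (L + 1) ^+ 2) by lra.
have [||mu [m01 mg hb]] := @cone_barrier_lipschitz R n
    (1 - (2 * (1 + (L + 1) ^+ 2))^-1) (2 / (1 + gamma)) n0.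
- apply/andP; split; last by rewrite gtrBl invr_gt0.
  by rewrite subr_gt0 invf_lt1 //; lra.
- by rewrite divr_gt0.
by exists mu; split => //; rewrite -ler_pdivlMr.
Qed.

Theorem corollary1p1 (R : realType) (m : nat) :
  exists mu : R -> R -> R,
  forall (gamma : R) (Om : set 'rV[R]_m.+1) (f : 'rV[R]_m.+1 -> R)
    (lambda Lambda : R) (u : 'rV[R]_m.+1 -> R),
  0 < gamma ->
  bounded_lipschitz_domain Om ->
  locally_holder Om f ->
  0 < lambda ->
  (forall X, Om X -> lambda <= f X <= Lambda) ->
  solution gamma Om f u ->
  [/\ 0 < mu gamma (lip_const Om) < 1 /\
      holder_on (mu gamma (lip_const Om)) (closure Om) u,
      1 < gamma -> C1_domain Om \/ convex_set Om ->
        holder_on (2 / (1 + gamma)) (closure Om) u /\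
        asymp Om u (fun X => dist X (boundary Om) `^ (2 / (1 + gamma))),
      gamma < 1 -> boundary Om 0 -> graph_near Om 0 (@C1_graph R m) ->
        exists r : R, 0 < r /\ forall alpha : R, 1 < alpha ->
          gtrsim (Om `&` eball 0 r) u (fun X => dist X (boundary Om) `^ alpha) &
      gamma < 1 -> boundary Om 0 -> graph_near Om 0 (@concave_graph R m) ->
        exists r : R, 0 < r /\
          gtrsim (Om `&` eball 0 r) u (fun X => dist X (boundary Om))].
Proof.
have [mu hmu] := choice (fun p : R * R =>
  @lipschitz_exponent R m.+1 p.1 p.2 (ltn0Sn m)).
exists (fun gamma L => mu (gamma, L)).
move=> gamma Om f lambda Lambda u g0 [neO oO cO bO hL] _ l0 hf su.
have hf1 X : Om X -> lambda <= f X by move=> /hf/andP[].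
have hf2 X : Om X -> 0 <= f X <= Lambda.
  by move=> /hf/andP[h1 ->]; rewrite (le_trans (ltW l0) h1).
split.
- have [L0 [L LO LL]] := lipschitz_with_lip_const hL.
  have [m01 mg hb] := hmu (gamma, lip_const Om) g0 L0; split => //.
  have /andP[m0 _] := m01.
  have [C hC] := boundary_decay g0 (ltW m0) mg hb oO bO hf2 su
    (lipschitz_exterior_cone LO LL).
  exact: holder_of_boundary_decay g0 oO bO hf2 su m01 mg hC.
- move=> g1 C1c; have gg : 0 < 1 + gamma by lra.
  have b01 : 0 < 2 / (1 + gamma) < 1.
    by rewrite divr_gt0 // ltr_pdivrMr // mul1r; lra.
  have bg : 2 / (1 + gamma) * (1 + gamma) <= 2 by rewrite divfK // lt0r_neq0.
  have [C hC] : exists C : R, forall P X, boundary Om P -> Om X ->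
      u X <= C * enorm (X - P) `^ (2 / (1 + gamma)).
    case: C1c => hO; first exact: C1_domain_decay g0 b01 bg oO bO hO hf2 su.
    exact: convex_decay g0 b01 bg oO bO neO hO hf2 su.
  split; first exact: holder_of_boundary_decay g0 oO bO hf2 su b01 bg hC.
  exact: asymp_dist g0 l0 oO bO hf1 su hC.
- by move=> _ b0 cg; apply: C1_graph_lower_bound g0 l0 oO bO hf1 su b0 cg.
- by move=> _ b0 cg; apply: concave_graph_lower_bound g0 l0 oO bO hf1 su b0 cg.
Qed.
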